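(* Let $p$ be a prime number, let $(R,\mathfrak m,k)$ be a Noetherian local ring with $p\in\mathfrak m$, and let $M$ be a nonzero $\mathfrak m$-adically complete $R$-module. Then $M$ is a balanced big Cohen--Macaulay $R$-module if and only if there is an $R$-algebra $A$ with $\mathfrak mA\ne A$ that satisfies condition (a) or condition (b) of the context, such that $\mathrm{Ext}_R^i(A,M)=0$ for all $i<\dim(R)$.
   Context: Rings are commutative with $1$. Complete modules are understood to be separated. $M$ is a balanced big Cohen--Macaulay $R$-module if $\mathfrak mM\ne M$ and every system of parameters of $R$ is a regular sequence on $M$. Conditions on an $R$-algebra $A$: (a) $A$ is perfectoid. (b) $A$ is reduced and contains an element $f_0=up$ with $u$ a unit of $A$, together with elements $f_0^{1/p^n}$ ($n\ge1$) with $(f_0^{1/p})^p=f_0$ and $(f_0^{1/p^{n+1}})^p=f_0^{1/p^n}$, such that $A/(f_0^{1/p^\infty})$ is a perfect $\mathbb F_p$-algebra (Frobenius bijective), where $(f_0^{1/p^\infty})$ is the ideal generated by all $f_0^{1/p^n}$. A ring $A$ is perfectoid (with respect to $p$) if: there is $\pi\in A$ such that $\pi^p$ divides $p$ and $A$ is $\pi$-adically complete (and separated); the Frobenius $A/pA\to A/pA$ is surjective; and the kernel of Fontaine's map $\theta\colon W(A^\flat)\to A$ is principal, where $A^\flat=\varprojlim_{x\mapsto x^p}A/pA$. *)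

(* Defs.v *)
From HB Require Import structures.
From mathcomp Require Import all_boot all_order all_algebra ring_quotient generic_quotient.
From mathcomp Require Import boolp classical_sets functions finmap.
From mathcomp.multinomials Require Import monalg.

Set Implicit Arguments.
Unset Strict Implicit.
Unset Printing Implicit Defensive.

Import GRing.Theory.

Local Open Scope classical_set_scope.
Local Open Scope ring_scope.
Local Open Scope quotient_scope.

Definition submodule (R : pzRingType) (M : lmodType R) (N : set M) : Prop :=
  N 0 /\ forall (a : R) (x y : M), N x -> N y -> N (a *: x + y).

Definition span (R : pzRingType) (M : lmodType R) (S : set M) : set M :=
  smallest (@submodule R M) S.

(* [smul I N] is the submodule I N; for a set I of scalars this is the same as
   (I) N, where (I) is the ideal generated by I. *)
Definition smul (R : pzRingType) (M : lmodType R) (I : set R) (N : set M) : set M :=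
  span [set v | exists2 a, I a & exists2 x, N x & v = a *: x].

Definition is_ideal (R : comPzRingType) (I : set R) : Prop :=
  @submodule R R^o I.

Definition ideal_gen (R : comPzRingType) (S : set R) : set R :=
  @span R R^o S.

Definition radical (R : comPzRingType) (I : set R) : set R :=
  [set x | exists n : nat, I (x ^+ n)].

Definition adic_filtration (R : comPzRingType) (I : set R) (M : lmodType R)
  (n : nat) : set M := iter n (smul I) setT.

(* M -> lim M / I^n M is injective (first clause) and surjective (second
   clause, where an element of the limit is given by representatives u n). *)
Definition adically_complete (R : comPzRingType) (I : set R) (M : lmodType R) :
    Prop :=
  (forall x : M, (forall n, adic_filtration I n x) -> x = 0) /\
  (forall u : nat -> M,
      (forall n, adic_filtration I n (u n.+1 - u n)) ->
      exists l : M, forall n, adic_filtration I n (u n - l)).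

Definition noetherian (R : comPzRingType) : Prop :=
  forall I : set R, is_ideal I -> exists s : seq R, I = ideal_gen [set` s].

Definition prime_ideal (R : comPzRingType) (P : set R) : Prop :=
  [/\ is_ideal P, ~ P 1 & forall x y, P (x * y) -> P x \/ P y].

Definition maximal_ideal (R : comPzRingType) (m : set R) : Prop :=
  [/\ is_ideal m, ~ m 1 &
      forall J : set R, is_ideal J -> m `<=` J -> ~ J 1 -> J = m].

Definition local_ring (R : comPzRingType) (m : set R) : Prop :=
  maximal_ideal m /\ forall n : set R, maximal_ideal n -> n = m.

Definition prime_chain (R : comPzRingType) (n : nat) : Prop :=
  exists P : nat -> set R,
    (forall i, (i <= n)%N -> prime_ideal (P i)) /\
    (forall i, (i < n)%N -> P i `<` P i.+1).

(* The largest length of a chain of prime ideals.  The default value 0 is only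
   used when there is no such largest length, which does not happen for a
   Noetherian local ring. *)
Definition krull_dim (R : comPzRingType) : nat :=
  xget 0%N [set d | prime_chain R d /\ forall n, prime_chain R n -> (n <= d)%N].

Definition system_of_parameters (R : comPzRingType) (m : set R) (xs : seq R) :
    Prop :=
  size xs = krull_dim R /\ radical (ideal_gen [set` xs]) = m.

Definition regular_sequence (R : comPzRingType) (M : lmodType R) (xs : seq R) :
    Prop :=
  (forall i, (i < size xs)%N ->
     let N := smul [set` take i xs] [set: M] in
     forall z : M, N (xs`_i *: z) -> N z) /\
  smul [set` xs] [set: M] <> setT.

Definition balanced_bigCM (R : comPzRingType) (m : set R) (M : lmodType R) :
    Prop :=
  smul m [set: M] <> setT /\
  forall xs, system_of_parameters m xs -> regular_sequence M xs.

Definition projective (R : pzRingType) (P : lmodType R) : Prop :=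
  forall (U V : lmodType R) (g : {linear U -> V}) (f : {linear P -> V}),
    (forall v, exists u, g u = v) ->
    exists h : {linear P -> U}, forall x, g (h x) = f x.

Record proj_resolution (R : pzRingType) (N : lmodType R) := ProjResolution {
  pr_mod : nat -> lmodType R;
  pr_d : forall n, {linear pr_mod n.+1 -> pr_mod n};
  pr_aug : {linear pr_mod 0%N -> N};
  pr_proj : forall n, projective (pr_mod n);
  pr_aug_surj : forall y, exists x, pr_aug x = y;
  pr_exact0 : forall x, pr_aug x = 0 <-> exists y, x = pr_d 0%N y;
  pr_exactS : forall n x, pr_d n x = 0 <-> exists y, x = pr_d n.+1 y }.

Definition coboundary (R : pzRingType) (N : lmodType R) (P : proj_resolution N)
    (M : lmodType R) (i : nat) : {linear pr_mod P i -> M} -> Prop :=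
  match i with
  | 0 => fun f => forall x, f x = 0
  | j.+1 => fun f => exists g : {linear pr_mod P j -> M},
                       forall x, f x = g (pr_d P j x)
  end.

(* Ext^i_R(N, M) = H^i(Hom_R(P, M)) for a projective resolution P of N; the
   cohomology does not depend on P up to isomorphism, and resolutions exist by
   [proj_resolution_exists] below. *)
Definition Ext_eq0 (R : pzRingType) (i : nat) (N M : lmodType R) : Prop :=
  forall (P : proj_resolution N) (f : {linear pr_mod P i -> M}),
    (forall x, f (pr_d P i x) = 0) -> coboundary f.

Section FreeResolution.
Variable R : nzRingType.

Definition lin_ext (K : choiceType) (V : lmodType R) (v : K -> V)
  (g : {malg R[K]}) : V := \sum_(k <- msupp g) g@_k *: v k.

Lemma lin_extEw (K : choiceType) (V : lmodType R) (v : K -> V)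
    (d : {fset K}) (g : {malg R[K]}) :
  (msupp g `<=` d)%fset -> lin_ext v g = \sum_(k <- d) g@_k *: v k.
Proof.
move=> le; rewrite /lin_ext (big_fset_incl _ le) //= => x xd /mcoeff_outdom ->.
by rewrite scale0r.
Qed.

Lemma lin_ext_linear (K : choiceType) (V : lmodType R) (v : K -> V) :
  linear (lin_ext v).
Proof.
move=> a g h; set d := (msupp g `|` msupp h)%fset.
have ged : (msupp g `<=` d)%fset by apply: fsubsetUl.
have hed : (msupp h `<=` d)%fset by apply: fsubsetUr.
have ghed : (msupp (a *: g + h) `<=` d)%fset.
  apply: fsubset_trans (msuppD_le _ _) _.
  by apply: fsetUSS => //; apply: msuppZ_le.
rewrite (lin_extEw _ ged) (lin_extEw _ hed) (lin_extEw _ ghed).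
rewrite scaler_sumr -big_split /=; apply: eq_bigr => k _.
by rewrite mcoeffD mcoeffZ scalerDl scalerA.
Qed.

HB.instance Definition _ (K : choiceType) (V : lmodType R) (v : K -> V) :=
  GRing.isLinear.Build R {malg R[K]} V *:%R (lin_ext v) (lin_ext_linear v).

Lemma lin_extU (K : choiceType) (V : lmodType R) (v : K -> V) k :
  lin_ext v << k >> = v k.
Proof. by rewrite /lin_ext msuppU oner_eq0 big_seq_fset1 mcoeffUU scale1r. Qed.

Lemma linear_malgE (K : choiceType) (V : lmodType R)
    (f : {linear {malg R[K]} -> V}) g :
  f g = lin_ext (fun k => f << k >>) g.
Proof.
rewrite {1}[g]monalgE raddf_sum; apply: eq_bigr => k _.
rewrite -linearZ; congr (f _); apply/malgP => l.
by rewrite mcoeffZ !mcoeffU mulrnAr mulr1.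
Qed.

Lemma free_projective (K : choiceType) : projective ({malg R[K]} : lmodType R).
Proof.
move=> U V g f gs.
pose u k := projT1 (cid (gs (f << k >>))).
have uE k : g (u k) = f << k >> by rewrite /u; case: cid.
exists (lin_ext u : {linear _ -> _}) => x.
rewrite (linear_malgE f) /lin_ext linear_sum; apply: eq_bigr => k _.
by rewrite linearZ /= uE.
Qed.

Variable N : lmodType R.

Definition cover (V : lmodType R) : {malg R[V]} -> V := lin_ext (@id V).
HB.instance Definition _ (V : lmodType R) := GRing.Linear.on (@cover V).

Definition in_syz (V : lmodType R) : pred {malg R[V]} :=
  fun g => cover g == 0.

Lemma in_syz_closed (V : lmodType R) : submod_closed (@in_syz V).
Proof.
split=> [|a x y]; rewrite !unfold_in /in_syz ?linear0 //.
move=> /eqP x0 /eqP y0; apply/eqP; rewrite [LHS]lin_ext_linear.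
by rewrite -!/(cover _) x0 y0 scaler0 addr0.
Qed.
HB.instance Definition _ (V : lmodType R) :=
  GRing.isSubmodClosed.Build R {malg R[V]} (@in_syz V) (in_syz_closed V).

Record syz_type (V : lmodType R) := Syz { syz_val : {malg R[V]};
                                          _ : syz_val \in @in_syz V }.
HB.instance Definition _ (V : lmodType R) := [isSub for @syz_val V].
HB.instance Definition _ (V : lmodType R) := [Choice of syz_type V by <:].
HB.instance Definition _ (V : lmodType R) :=
  [SubChoice_isSubLmodule of syz_type V by <:].

Definition syz (V : lmodType R) : lmodType R := syz_type V.

Lemma cover_surj (V : lmodType R) (y : V) : exists x, cover x = y.
Proof. by exists << y >>; rewrite /cover lin_extU. Qed.

Lemma coverP (V : lmodType R) (x : {malg R[V]}) :
  cover x = 0 <-> exists y : {malg R[syz V]}, x = val (cover y).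
Proof.
split=> [x0|[y ->]]; last by apply/eqP; exact: (valP (cover y)).
have xin : x \in @in_syz V by apply/eqP.
by have [y yE] := cover_surj (Syz xin : syz V); exists y; rewrite yE.
Qed.

Lemma proj_resolution_exists : inhabited (proj_resolution N).
Proof.
pose V n := iter n syz N.
pose P n : lmodType R := {malg R[V n]}.
pose d n : {linear P n.+1 -> P n} := val \o @cover (syz (V n)).
constructor; apply: (@ProjResolution _ N P d (@cover N)).
- by move=> n; apply: free_projective.
- exact: cover_surj.
- by move=> x; apply: (@coverP N).
- have val0 n : val (0 : syz (V n)) = 0.
    by exact: (raddf0 (val : {linear syz (V n) -> P n})).
  move=> n x; rewrite -(@coverP (V n.+1)) /d /=; split=> [x0|->]; last exact: val0.
  by apply: val_inj; rewrite [RHS]val0.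
Qed.

End FreeResolution.

Lemma submodule_span (R : pzRingType) (M : lmodType R) (S : set M) :
  submodule (span S).
Proof.
split=> [N [[]//]|a x y xS yS N [Nsub SN]].
by apply: Nsub.2; [apply: xS | apply: yS].
Qed.

Section QuotientRing.
Variables (R : comPzRingType) (S : set R).

Definition in_ideal_gen (x : R) : bool := `[< ideal_gen S x >].

Lemma in_ideal_genE x : (x \in in_ideal_gen) = `[< ideal_gen S x >].
Proof. by []. Qed.

Lemma in_ideal_gen_zmod : zmod_closed in_ideal_gen.
Proof.
have [S0 SD] := @submodule_span R R^o S.
split=> [|x y]; rewrite !in_ideal_genE; first exact/asboolP.
move=> /asboolP xS /asboolP yS; apply/asboolP.
have -> : x - y = -1 * y + x by rewrite mulN1r addrC.
exact: SD.
Qed.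

Lemma in_ideal_genM a x : x \in in_ideal_gen -> a * x \in in_ideal_gen.
Proof.
have [S0 SD] := @submodule_span R R^o S.
rewrite !in_ideal_genE => /asboolP xS; apply/asboolP.
by rewrite -[a * x]addr0; apply: (SD a x 0).
Qed.

HB.instance Definition _ :=
  GRing.isZmodClosed.Build R in_ideal_gen in_ideal_gen_zmod.

(* The quotient of R by the ideal generated by S; it may be the zero ring. *)
Definition quot_ring :=
  Quotient.quot (GRing.ZmodClosed.clone R in_ideal_gen _).

HB.instance Definition _ := GRing.Zmodule.on quot_ring.
HB.instance Definition _ := EqQuotient.on quot_ring.

Definition quot_one : quot_ring := \pi_quot_ring 1.
Definition quot_mul (x y : quot_ring) : quot_ring := \pi_quot_ring (repr x * repr y).

Definition quot_pi (x : R) : quot_ring := \pi_quot_ring x.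

Lemma quot_piP x y : quot_pi x = quot_pi y <-> ideal_gen S (x - y).
Proof.
split=> [/eqP|xy]; rewrite /quot_pi.
  by rewrite -Quotient.idealrBE => /asboolP.
by apply/eqP; rewrite -Quotient.idealrBE; apply/asboolP.
Qed.

Lemma quot_piM x y : quot_pi (x * y) = quot_mul (quot_pi x) (quot_pi y).
Proof.
have ideq z : z - repr (quot_pi z) \in in_ideal_gen.
  by rewrite Quotient.idealrBE reprK.
apply/quot_piP/asboolP; rewrite -in_ideal_genE.
rewrite -[x * y](addrNK (x * repr (quot_pi y))) -mulrBr.
rewrite -addrA -mulrBl; apply: rpredD; first exact: in_ideal_genM.
by rewrite mulrC; apply: in_ideal_genM.
Qed.

Lemma quot_reprK (x : quot_ring) : quot_pi (repr x) = x.
Proof. exact: reprK. Qed.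

Lemma quot_piD x y : quot_pi (x + y) = quot_pi x + quot_pi y.
Proof. by rewrite /quot_pi piE. Qed.

Lemma quot_mulA : associative quot_mul.
Proof.
move=> x y z; rewrite -[x]quot_reprK -[y]quot_reprK -[z]quot_reprK.
by rewrite -!quot_piM mulrA.
Qed.

Lemma quot_mulC : commutative quot_mul.
Proof.
move=> x y; rewrite -[x]quot_reprK -[y]quot_reprK.
by rewrite -!quot_piM mulrC.
Qed.

Lemma quot_mul1 : left_id quot_one quot_mul.
Proof.
by move=> x; rewrite -[x]quot_reprK -[quot_one]/(quot_pi 1) -quot_piM mul1r.
Qed.

Lemma quot_mulD : left_distributive quot_mul +%R.
Proof.
move=> x y z; rewrite -[x]quot_reprK -[y]quot_reprK -[z]quot_reprK.
by rewrite -quot_piD -!quot_piM -quot_piD mulrDl.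
Qed.

HB.instance Definition _ := GRing.Zmodule_isComPzRing.Build quot_ring
  quot_mulA quot_mulC quot_mul1 quot_mulD.

Lemma quot_pi_zmod : zmod_morphism quot_pi.
Proof. by move=> x y; rewrite /quot_pi piE. Qed.
HB.instance Definition _ :=
  GRing.isZmodMorphism.Build R quot_ring quot_pi quot_pi_zmod.

Lemma quot_pi_monoid : monoid_morphism quot_pi.
Proof. by split=> // x y; rewrite quot_piM. Qed.
HB.instance Definition _ :=
  GRing.isMonoidMorphism.Build R quot_ring quot_pi quot_pi_monoid.

End QuotientRing.

Section ModP.
Variables (p : nat) (R : comPzRingType).

Lemma ideal_gen_natP (x : R) :
  ideal_gen [set p%:R] x <-> exists c, x = c *+ p.
Proof.
split=> [|[c ->] N [[N0 ND] Np]]; last first.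
  by rewrite -mulr_natr -[_ * _]addr0; apply: (ND c p%:R 0) => //; apply: Np.
apply: (@smallest_sub _ (@submodule R R^o) _ [set x | exists c, x = c *+ p]).
  split=> [|a _ _ [c ->] [d ->]]; first by exists 0; rewrite mul0rn.
  by exists (a * c + d); rewrite mulrnDl -mulrnAr.
by move=> _ ->; exists 1.
Qed.

Lemma quot_natr0 : p%:R = 0 :> quot_ring [set p%:R : R].
Proof.
rewrite -(rmorph_nat (quot_pi [set p%:R])) -(rmorph0 (quot_pi [set p%:R])).
by apply/quot_piP; rewrite subr0; apply/ideal_gen_natP; exists 1.
Qed.

End ModP.

Section Frobenius.
Variables (p : nat) (p_prime : prime p) (B : comPzRingType).
Hypothesis p0 : p%:R = 0 :> B.

Lemma frobD (x y : B) : (x + y) ^+ p = x ^+ p + y ^+ p.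
Proof.
case: p p_prime p0 => // q q_prime q0; rewrite exprDn big_ord_recl big_ord_recr /=.
rewrite bin0 binn !mulr1n subn0 expr0 mulr1 /bump leq0n add1n subnn expr0 mul1r.
rewrite big1 ?add0r // => i _.
have /dvdnP[k ->] : (q.+1 %| 'C(q.+1, bump 0 i))%N.
  by apply: prime_dvd_bin => //; apply/andP; split=> //=; rewrite ltnS; apply: ltn_ord.
by rewrite mulrnA -[_ *+ q.+1]mulr_natr q0 mulr0.
Qed.

Lemma frobN (x : B) : (- x) ^+ p = - x ^+ p.
Proof.
apply/eqP; rewrite -addr_eq0 -frobD addNr.
by case: p p_prime => // q _; rewrite expr0n.
Qed.

Lemma frob0 : 0 ^+ p = 0 :> B.
Proof. by case: p p_prime => // q _; rewrite expr0n. Qed.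

Lemma frob_int (c : int) : (c%:~R : B) ^+ p = c%:~R.
Proof.
have natE n : (n%:R : B) ^+ p = n%:R.
  elim: n => [|n IHn]; first exact: frob0.
  by rewrite -natr1 frobD expr1n IHn.
case: c => n; first by rewrite -pmulrn natE.
by rewrite NegzE mulrNz -pmulrn frobN natE.
Qed.

Lemma frob_sum (I : Type) (r : seq I) (F : I -> B) :
  (\sum_(i <- r) F i) ^+ p = \sum_(i <- r) F i ^+ p.
Proof. exact: (big_morph (fun x => x ^+ p) frobD frob0). Qed.

End Frobenius.

(* The n-th Witt polynomial \sum_(i <= n) p^i X_i^(p^(n-i)), evaluated at x. *)
Definition ghost (p : nat) (B : comPzRingType) (n : nat) (x : nat -> B) : B :=
  \sum_(i < n.+1) x i ^+ (p ^ (n - i)) *+ p ^ i.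

(* Z[X_0, Y_0, X_1, Y_1, ...]; the variables are indexed by (b, n) where b = 0
   stands for X and b = 1 for Y. *)
Notation witt_var := (bool * nat)%type.
Notation witt_polyring := {malg int[{cmonom witt_var}]}.

Definition witt_X (n : nat) : witt_polyring := << ucm (false, n) >>.
Definition witt_Y (n : nat) : witt_polyring := << ucm (true, n) >>.

Section Dwork.
Variables (p : nat) (p_prime : prime p) (F : comPzRingType).
Variable phi : {rmorphism F -> F}.
Hypothesis phi_lift : forall f, exists c, phi f = f ^+ p + c *+ p.

Lemma cong_expp (a b : F) k : (0 < k)%N ->
  (exists c, a = b + c *+ p ^ k) -> exists c, a ^+ p = b ^+ p + c *+ p ^ k.+1.
Proof.
case: k => // k _ [c ->].
set t := c *+ p ^ k.+1.
have [d dE] : exists d, \sum_(i < p) (b + t) ^+ (p.-1 - i) * b ^+ i = d *+ p.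
  have tM n : exists e, (b + t) ^+ n = b ^+ n + e *+ p.
    elim: n => [|n [e eE]]; first by exists 0; rewrite mul0rn addr0 !expr0.
    exists (c *+ p ^ k * b ^+ n + (b + t) * e).
    rewrite exprS eE mulrDr mulrDl -exprS -addrA; congr (_ + _).
    by rewrite mulrnDl -mulrnAl -mulrnAr /t expnSr mulrnA.
  pose e n := projT1 (cid (tM n)).
  have eE n : (b + t) ^+ n = b ^+ n + e n *+ p by rewrite /e; case: cid.
  exists (b ^+ p.-1 + \sum_(i < p) e (p.-1 - i)%N * b ^+ i).
  rewrite mulrnDl -sumrMnl.
  transitivity (\sum_(i < p) (b ^+ p.-1 + (e (p.-1 - i)%N * b ^+ i) *+ p)).
    apply: eq_bigr => i _; rewrite eE mulrDl -exprD subnK ?mulrnAl //.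
    by rewrite -ltnS prednK ?prime_gt0.
  by rewrite big_split /= sumr_const card_ord.
exists (c * d).
rewrite -[LHS](subrK (b ^+ p)) addrC; congr (_ + _).
rewrite subrXX [b + t]addrC addrK -[t + b]addrC dE.
by rewrite /t mulrnAl mulrnAr -mulrnA -expnS.
Qed.

Lemma cong_exppX (a b : F) k :
  (exists c, a = b + c *+ p) ->
  exists c, a ^+ (p ^ k) = b ^+ (p ^ k) + c *+ p ^ k.+1.
Proof.
move=> ab; elim: k => [|k IHk]; first by rewrite expn0 !expr1 expn1.
by rewrite [(p ^ k.+1)%N]expnSr !exprM; apply: cong_expp.
Qed.

Lemma ghost_surj (G : nat -> F) :
  (forall n, exists c, G n.+1 = phi (G n) + c *+ p ^ n.+1) ->
  exists z : nat -> F, forall n, ghost p n z = G n.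
Proof.
move=> GP.
pose rest (z : nat -> F) n := \sum_(i < n) z i ^+ (p ^ (n - i)) *+ p ^ i.
pose next (z : nat -> F) n := xget 0 [set c | G n = rest z n + c *+ p ^ n].
pose fix zs n : nat -> F := if n is k.+1 then
  fun i => if i == k then next (zs k) k else zs k i else fun=> 0.
pose z n := zs n.+1 n.
have zsE n i : (i < n)%N -> zs n i = z i.
  elim: n => // n IHn; rewrite ltnS leq_eqVlt => /orP[/eqP->//|lt_in] /=.
  by rewrite (ltn_eqF lt_in) IHn.
have zE n : z n = next z n.
  have restE : rest (zs n) n = rest z n by apply: eq_bigr => i _; rewrite zsE.
  by rewrite /z /= eqxx /next restE.
have ghostE n : ghost p n z = rest z n + z n *+ p ^ n.
  by rewrite /ghost big_ord_recr /= subnn expn0 expr1.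
exists z => n; rewrite ghostE zE /next.
suff [c cE] : exists c, G n = rest z n + c *+ p ^ n.
  by case: xgetP => [_ -> <- //|/(_ c)].
elim: n => [|n [c0 c0E]].
  by exists (G 0%N); rewrite /rest big_ord0 add0r expn0.
have Gn : G n = ghost p n z.
  by rewrite ghostE zE /next; case: xgetP => [_ -> <- //|/(_ c0)].
have [c ->] := GP n; rewrite Gn /ghost raddf_sum /=.
have term i : exists d, (i <= n)%N ->
    phi (z i ^+ (p ^ (n - i)) *+ p ^ i) =
    z i ^+ (p ^ (n.+1 - i)) *+ p ^ i + d *+ p ^ n.+1.
  have [d dE] := @cong_exppX (phi (z i)) (z i ^+ p) (n - i) (phi_lift _).
  exists d => le_in; rewrite rmorphMn rmorphXn /= dE mulrnDl -exprM -expnS -subSn //.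
  by rewrite -mulrnA -expnD subnK // ltnW.
pose d i := projT1 (cid (term i)).
exists (\sum_(i < n.+1) d i + c); rewrite mulrnDl addrA; congr (_ + _).
rewrite -sumrMnl -big_split /=; apply: eq_bigr => i _.
by rewrite /d; case: cid => e /= ->; rewrite // -ltnS.
Qed.

Lemma ghost_phi (x : nat -> F) n : (forall i, phi (x i) = x i ^+ p) ->
  ghost p n.+1 x = phi (ghost p n x) + x n.+1 *+ p ^ n.+1.
Proof.
move=> xE; rewrite /ghost big_ord_recr /= subnn expn0 expr1; congr (_ + _).
rewrite raddf_sum; apply: eq_bigr => i _ /=.
rewrite rmorphMn rmorphXn /= xE -exprM -expnS -subSn //.
by rewrite -ltnS.
Qed.

Lemma ghost_mul_exists (x y : nat -> F) :
  (forall i, phi (x i) = x i ^+ p) -> (forall i, phi (y i) = y i ^+ p) ->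
  exists z : nat -> F, forall n, ghost p n z = ghost p n x * ghost p n y.
Proof.
move=> xE yE; apply: ghost_surj => n.
rewrite !ghost_phi // rmorphM /=.
set a := phi _; set b := phi _.
exists (x n.+1 * (b + y n.+1 *+ p ^ n.+1) + a * y n.+1).
by rewrite mulrDl [a * _]mulrDr -addrA mulrnDl mulrnAr mulrnAl [X in _ + X = _]addrC.
Qed.

End Dwork.

Section WittPolynomials.
Variables (p : nat) (p_prime : prime p).

Definition witt_frob_monom (k : {cmonom witt_var}) : witt_polyring :=
  << k >> ^+ p.

Lemma witt_frob_monom_morph : mmorphism witt_frob_monom.
Proof.
split=> [k l|]; rewrite /witt_frob_monom; last by rewrite expr1n.
have -> : << mmul k l >> = << k >> * << l >> :> witt_polyring.
  by rewrite malgM_def fgmulUU mulr1.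
by rewrite exprMn.
Qed.

HB.instance Definition _ :=
  isMultiplicative.Build _ _ witt_frob_monom witt_frob_monom_morph.

Definition witt_frob : witt_polyring -> witt_polyring :=
  mmap intr witt_frob_monom.
HB.instance Definition _ := GRing.RMorphism.copy witt_frob
  (mmap intr witt_frob_monom).

Lemma malg_intE (f : witt_polyring) :
  f = \sum_(k <- msupp f) (f@_k)%:~R * << k >>.
Proof.
rewrite {1}[f]monalgE; apply: eq_bigr => k _.
by rewrite mulrzl -raddfMz intz.
Qed.

Lemma witt_frobP (f : witt_polyring) :
  exists c, witt_frob f = f ^+ p + c *+ p.
Proof.
suff /quot_piP/ideal_gen_natP[c cE] :
    quot_pi [set p%:R] (witt_frob f) = quot_pi [set p%:R] (f ^+ p).
  by exists c; rewrite -cE addrC subrK.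
set q := quot_pi _.
have qE : q f = \sum_(k <- msupp f) (f@_k)%:~R * q << k >>.
  rewrite {1}[f]malg_intE [LHS]rmorph_sum.
  by apply: eq_bigr => k _; rewrite [LHS]rmorphM rmorph_int.
transitivity (\sum_(k <- msupp f) (f@_k)%:~R * q << k >> ^+ p).
  rewrite /witt_frob mmapE [LHS]rmorph_sum; apply: eq_bigr => k _.
  by rewrite [LHS]rmorphM rmorph_int -rmorphXn.
have -> : q (f ^+ p) = q f ^+ p by exact: rmorphXn.
have p0 := @quot_natr0 p witt_polyring.
rewrite qE (frob_sum p_prime p0); apply: eq_bigr => k _.
by rewrite exprMn (frob_int p_prime p0).
Qed.

Lemma witt_frobU k : witt_frob << k >> = << k >> ^+ p.
Proof. by rewrite /witt_frob mmapU mul1r. Qed.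

Lemma witt_mul_poly_exists : exists P : nat -> witt_polyring,
  forall n, ghost p n P = ghost p n witt_X * ghost p n witt_Y.
Proof.
exact: (ghost_mul_exists p_prime witt_frobP (fun i => witt_frobU _)
                         (fun i => witt_frobU _)).
Qed.

(* The integer polynomials giving the multiplication of Witt vectors; since
   the polynomial ring is torsion-free, [witt_mul_polyP] determines them. *)
Definition witt_mul_poly : nat -> witt_polyring :=
  projT1 (cid witt_mul_poly_exists).

Lemma witt_mul_polyP n :
  ghost p n witt_mul_poly = ghost p n witt_X * ghost p n witt_Y.
Proof. by rewrite /witt_mul_poly; case: cid. Qed.

End WittPolynomials.

Definition witt_eval (B : comPzRingType) (x y : nat -> B)
    (f : witt_polyring) : B :=
  \sum_(k <- msupp f)
    (\prod_(v <- finsupp k) (if v.1 then y v.2 else x v.2) ^+ k v) *~ f@_k.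

Definition witt (B : comPzRingType) := nat -> B.

Definition witt_mul (p : nat) (p_prime : prime p) (B : comPzRingType)
    (x y : witt B) : witt B :=
  fun n => witt_eval x y (witt_mul_poly p_prime n).

Definition padic_lim (p : nat) (A : comPzRingType) (u : nat -> A) : A :=
  xget 0 [set l | forall k, exists N, forall n, (N <= n)%N ->
                    exists c, u n - l = c *+ p ^ k].

Section Perfectoid.
Variables (p : nat) (p_prime : prime p) (A : comPzRingType).

Notation A_mod_p := (quot_ring [set p%:R : A]).

(* The primality of p is an argument because the tilt is only a ring (for the
   componentwise operations) when p is prime. *)
Definition in_tilt (_ : prime p) (x : nat -> A_mod_p) : bool :=
  `[< forall n, x n.+1 ^+ p = x n >].

Lemma in_tilt_closed : subring_closed (in_tilt p_prime).
Proof.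
have p0 := @quot_natr0 p A.
split=> [|x y|x y]; rewrite !unfold_in.
- by apply/asboolP => n; rewrite expr1n.
- move=> /asboolP xT /asboolP yT; apply/asboolP => n.
  by rewrite -[RHS]/(x n - y n) -xT -yT -(frobN p_prime p0) -(frobD p_prime p0).
- move=> /asboolP xT /asboolP yT; apply/asboolP => n.
  by rewrite -[RHS]/(x n * y n) -xT -yT -exprMn.
Qed.

Record tilt := Tilt { tilt_val :> nat -> A_mod_p;
                      _ : tilt_val \in in_tilt p_prime }.
HB.instance Definition _ := [isSub for tilt_val].
HB.instance Definition _ := [Choice of tilt by <:].
HB.instance Definition _ :=
  GRing.SubChoice_isSubComPzRing.Build (nat -> A_mod_p) _ tilt in_tilt_closed.

Lemma tilt_shift_subproof (i : nat) (x : tilt) :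
  (fun n => x (n + i)%N) \in in_tilt p_prime.
Proof.
by apply/asboolP => n; have /asboolP := valP x; rewrite addSn; apply.
Qed.

(* The coordinates of x^(1/p^i) are those of x, shifted by i. *)
Definition tilt_root (i : nat) (x : tilt) : tilt :=
  Tilt (tilt_shift_subproof i x).

Definition tilt_sharp (x : tilt) : A :=
  padic_lim p (fun n => repr (x n) ^+ (p ^ n)).

(* Fontaine's map: a Witt vector (x_0, x_1, ...) over the perfect ring A^flat
   is \sum_i p^i [x_i^(1/p^i)], and theta sends the Teichmuller lift [x] to
   x^sharp.  The limits exist and are unique when A is p-adically complete,
   which follows from pi-adic completeness if pi^p divides p. *)
Definition theta (x : witt tilt) : A :=
  padic_lim p (fun n => \sum_(i < n) tilt_sharp (tilt_root i (x i)) *+ p ^ i).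

(* Only the multiplication of W(A^flat) is needed to say that the kernel of
   theta is the set of multiples of some xi. *)
Definition perfectoid : Prop :=
  [/\ exists pi : A, (exists c, p%:R = c * pi ^+ p) /\
                     @adically_complete A (ideal_gen [set pi]) A^o,
      forall y : A_mod_p, exists x, x ^+ p = y
    & exists xi : witt tilt, forall x : witt tilt,
        theta x = 0 <-> exists y, x = witt_mul p_prime y xi].

End Perfectoid.

Definition reduced (A : comPzRingType) : Prop :=
  forall (x : A) (n : nat), x ^+ n = 0 -> x = 0.

Definition perfect_Fp_algebra (p : nat) (B : comPzRingType) : Prop :=
  p%:R = 0 :> B /\ bijective (fun x : B => x ^+ p).

(* f n is f_0^(1/p^n). *)
Definition perfect_mod_p_roots (p : nat) (A : comPzRingType) : Prop :=
  reduced A /\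
  exists (u : A) (f : nat -> A),
    [/\ exists v, u * v = 1,
        f 0%N = u * p%:R,
        forall n, f n.+1 ^+ p = f n
      & perfect_Fp_algebra p (quot_ring (range f))].

(* Main.v *)
(** If Ext^i(A, M) = 0 for i < d, then for every complex of copies of M that is
    exact below degree s < d, dimension shifting gives Hom(A, H^s) = 0.  Apply
    this to the Koszul complex on a system of parameters x and to its lowest
    nonzero cohomology H^s: it is killed by (x), so it has an element killed by
    m, and mA <> A provides a nonzero map A -> k -> H^s.  Hence the cohomology
    vanishes below degree d; in particular H_1(x; M) = 0.  Nakayama's lemma for
    the complete module M removes the elements of x one at a time, and the
    vanishing of all H_1(x_1, ..., x_n; M) says that x is M-regular.

    Conversely, let A be the perfect closure of the residue field: it satisfies
    condition (b) with f_0 = 0, and it is killed by a system of parameters, so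
    Ext^i(A, M) = 0 for i < d by induction on i along the regular sequence. *)

Require Import Defs.
From HB Require Import structures.
From mathcomp Require Import all_boot all_order all_algebra.
From mathcomp Require Import boolp classical_sets functions.

Set Implicit Arguments.
Unset Strict Implicit.
Unset Printing Implicit Defensive.

Import GRing.Theory.

Local Open Scope classical_set_scope.
Local Open Scope ring_scope.

(** * Submodules and projective resolutions *)

Section Submodules.
Variables (R : pzRingType) (M : lmodType R).

Section SubmoduleTheory.
Variables (N : set M) (subN : submodule N).

Lemma submodule0 : N 0. Proof. exact: subN.1. Qed.

Lemma submoduleZ a x : N x -> N (a *: x).
Proof. by move=> Nx; rewrite -[_ *: _]addr0; apply: subN.2 => //; apply: subN.1. Qed.

Lemma submoduleD x y : N x -> N y -> N (x + y).
Proof. by move=> Nx Ny; rewrite -[x]scale1r; apply: subN.2. Qed.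

Lemma submoduleN x : N x -> N (- x).
Proof. by rewrite -scaleN1r; apply: submoduleZ. Qed.

Lemma submoduleB x y : N x -> N y -> N (x - y).
Proof. by move=> Nx /submoduleN; apply: submoduleD. Qed.

Lemma submoduleBr x y : N (x - y) -> N y -> N x.
Proof. by move=> Nxy Ny; rewrite -(subrK y x); apply: submoduleD. Qed.

End SubmoduleTheory.

Lemma submodule_set0 : submodule [set 0 : M].
Proof. by split=> // a x y /= -> ->; rewrite scaler0 addr0. Qed.

Lemma submodule_setT : submodule [set: M].
Proof. by []. Qed.

Lemma subset_span (S : set M) : S `<=` Defs.span S.
Proof. exact: sub_gen_smallest. Qed.

Lemma span_sub (S N : set M) : submodule N -> S `<=` N -> Defs.span S `<=` N.
Proof. exact: smallest_sub. Qed.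

Lemma submodule_smul (I : set R) (N : set M) : submodule (smul I N).
Proof. exact: submodule_span. Qed.

Lemma smulZ (I : set R) (N : set M) a x : I a -> N x -> smul I N (a *: x).
Proof. by move=> Ia Nx; apply: subset_span; exists a => //; exists x. Qed.

Lemma smul_sub (I : set R) (N W : set M) : submodule W ->
  (forall a x, I a -> N x -> W (a *: x)) -> smul I N `<=` W.
Proof. by move=> subW IW; apply: span_sub => // _ [a Ia [x Nx ->]]; apply: IW. Qed.

Lemma smulS (I J : set R) (N : set M) : I `<=` J -> smul I N `<=` smul J N.
Proof.
by move=> IJ; apply: smul_sub (@submodule_smul _ _) _ => a x /IJ; apply: smulZ.
Qed.

End Submodules.

Arguments submodule_set0 {R M}.
Arguments submodule_setT {R M}.

(** The set is B + yM; commutativity of R makes yM stable under scalars. *)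
Lemma submodule_preim_scale (R : comPzRingType) (M : lmodType R) (B : set M)
    (y : R) :
  submodule B -> submodule [set v | exists w, B (v - y *: w)].
Proof.
move=> subB; split=> [|a u v [w wB] [w' wB']].
  by exists 0; rewrite scaler0 subr0; apply: submodule0.
exists (a *: w + w'); rewrite scalerDr scalerA mulrC -scalerA opprD addrACA -scalerBr.
exact: subB.2.
Qed.

Lemma smul_rcons (R : comPzRingType) (M : lmodType R) (s : seq R) (x : R) (v : M) :
  smul [set` rcons s x] [set: M] v <->
  exists w, smul [set` s] [set: M] (v - x *: w).
Proof.
split=> [|[w sw]]; last first.
  apply: (submoduleBr (submodule_smul _ _) (y := x *: w)).
    by apply: smulS sw => a /=; rewrite mem_rcons inE => ->; rewrite orbT.
  by apply: smulZ => //=; rewrite mem_rcons mem_head.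
apply: (smul_sub (submodule_preim_scale x (submodule_smul _ _))).
move=> a z.
rewrite /= mem_rcons inE => /predU1P[->|sa] _.
  by exists z; rewrite subrr; apply: submodule0; apply: submodule_smul.
by exists 0; rewrite scaler0 subr0; apply: smulZ.
Qed.

Section SubmoduleType.
Variables (R : pzRingType) (V : lmodType R) (S : set V).

(** The proof is carried as an argument so that the module structure can be inferred from the
    type. *)
Definition in_submodule (_ : submodule S) (v : V) : bool := `[< S v >].

Variable subS : submodule S.

Lemma in_submodule_closed : submod_closed (in_submodule subS).
Proof.
split=> [|a x y]; rewrite !unfold_in; first by apply/asboolP; apply: submodule0.
by move=> /asboolP Sx /asboolP Sy; apply/asboolP/subS.2.
Qed.
HB.instance Definition _ :=
  GRing.isSubmodClosed.Build R V (in_submodule subS) in_submodule_closed.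

Record submodule_type := SubmoduleType {
  submodule_val : V; _ : submodule_val \in in_submodule subS }.
HB.instance Definition _ := [isSub for submodule_val].
HB.instance Definition _ := [Choice of submodule_type by <:].
HB.instance Definition _ := [SubChoice_isSubLmodule of submodule_type by <:].

Definition submodule_mod : lmodType R := submodule_type.

Definition submodule_incl : {linear submodule_mod -> V} := val.

Lemma submodule_inclP u : S (submodule_incl u).
Proof. exact/asboolP/(valP u). Qed.

Lemma submodule_incl_onto v : S v -> exists u, submodule_incl u = v.
Proof. by move=> /asboolP Sv; exists (SubmoduleType Sv). Qed.

End SubmoduleType.

Section ProjectiveLifting.
Variables (R : pzRingType) (P U V : lmodType R) (projP : projective P).
Variables (B : set V) (subB : submodule B).
Variables (phi : {linear U -> V}) (g : {linear P -> V}).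

(* Apply projectivity to the pullback {(u, x) | phi u = g x mod B} -> P. *)
Lemma projective_lift_mod : (forall x, exists u, B (phi u - g x)) ->
  exists h : {linear P -> U}, forall x, B (phi (h x) - g x).
Proof.
move=> surj.
pose S : set (U * P)%type := [set w | B (phi w.1 - g w.2)].
have subS : submodule S.
  split=> [|a [u x] [u' x'] /= Bu Bu'].
    rewrite -[S 0]/(B (phi 0 - g 0)) (linear0 phi) (linear0 g) subr0.
    exact: submodule0.
  rewrite -[S _]/(B (phi (a *: u + u') - g (a *: x + x'))) (linearP phi) (linearP g).
  rewrite opprD addrACA -scalerBr; exact: subB.2.
pose pr2 : {linear submodule_mod subS -> P} := snd \o submodule_incl subS.
have pr2_surj x : exists w, pr2 w = x.
  have [u Bu] := surj x.
  have [w wE] := @submodule_incl_onto _ _ _ subS (u, x) Bu.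
  by exists w; rewrite -[pr2 w]/(submodule_incl subS w).2 wE.
have [k kP] := projP idfun pr2_surj.
pose h : {linear P -> U} := fst \o submodule_incl subS \o k.
exists h => x; have := submodule_inclP (k x); rewrite /S /=.
by have /= -> := kP x.
Qed.

End ProjectiveLifting.

Lemma projective_lift (R : pzRingType) (P U V : lmodType R)
    (phi : {linear U -> V}) (g : {linear P -> V}) :
  projective P -> (forall x, exists u, phi u = g x) ->
  exists h : {linear P -> U}, forall x, phi (h x) = g x.
Proof.
move=> projP surj.
have [|h hP] := projective_lift_mod projP submodule_set0 (phi := phi) (g := g).
  by move=> x; have [u uE] := surj x; exists u; rewrite uE subrr.
by exists h => x; apply/eqP; rewrite -subr_eq0; apply/eqP/hP.
Qed.

Section Resolution.
Variables (R : pzRingType) (N : lmodType R) (P : proj_resolution N).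

Lemma pr_dd i x : pr_d P i (pr_d P i.+1 x) = 0.
Proof. by apply/pr_exactS; exists x. Qed.

Lemma coboundary_cocycle (M : lmodType R) i (f : {linear pr_mod P i -> M}) x :
  coboundary f -> f (pr_d P i x) = 0.
Proof.
by case: i f x => [|i] f x /=; [apply | move=> [g ->]; rewrite pr_dd linear0].
Qed.

End Resolution.

(** Multiplication by y on P lifts the zero map of N, so it is null-homotopic; only the relation d h
    d = y d is kept. *)
Lemma resolution_homotopy (R : comPzRingType) (N : lmodType R)
    (P : proj_resolution N) (y : R) i : (forall x : N, y *: x = 0) ->
  exists h : {linear pr_mod P i -> pr_mod P i.+1},
    forall v, pr_d P i (h (pr_d P i v)) = y *: pr_d P i v.
Proof.
move=> yN; elim: i => [|i [h hP]].
  have [|h hP] := projective_lift (phi := pr_d P 0%N) (g := y \*: idfun)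
                                  (pr_proj (p := P) (n := 0%N)).
    move=> x; have [|u uE] := (pr_exact0 (p := P) (y *: x)).1; last first.
      by exists u; rewrite -uE.
    by rewrite linearZ /= yN.
  by exists h => v; rewrite hP.
(* By induction d kills y - h d, so this map lifts through the next differential. *)
pose g : {linear pr_mod P i.+1 -> pr_mod P i.+1} := (y \*: idfun) \- (h \o pr_d P i).
have [|h' hP'] := projective_lift (phi := pr_d P i.+1) (g := g)
                                  (pr_proj (p := P) (n := i.+1)).
  move=> x; have [|u uE] := (pr_exactS (p := P) (g x)).1; last by exists u; rewrite -uE.
  by rewrite /g /= linearB linearZ /= hP subrr.
by exists h' => v; rewrite hP' /g /= pr_dd linear0 subr0.
Qed.

(** * Vanishing of Ext along a regular sequence *)

Section ExtVanishing.
Variables (R : comPzRingType) (N M : lmodType R) (P : proj_resolution N).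

(** Regularity of [ys] on M/B, expressed inside M to avoid quotient modules: each step replaces B by
    B + yM. Nonvanishing of the last quotient is not part of it. *)
Fixpoint regular_mod (B : set M) (ys : seq R) : Prop :=
  if ys is y :: ys' then
    (forall z, B (y *: z) -> B z) /\
    regular_mod [set v | exists w, B (v - y *: w)] ys'
  else True.

(* For B = 0 this is the vanishing of Ext^i(N, M); in general it is that of
   Ext^i(N, M/B). *)
Lemma regular_mod_coboundary i (ys : seq R) (B : set M)
    (f : {linear pr_mod P i -> M}) :
  (forall y, y \in ys -> forall x : N, y *: x = 0) -> (i < size ys)%N ->
  submodule B -> regular_mod B ys -> (forall x, B (f (pr_d P i x))) ->
  exists2 b : {linear pr_mod P i -> M}, coboundary b & forall x, B (f x - b x).
Proof.
elim: i ys B f => [|i IHi] [//|y ys] B f ysN ltis subB [regy regys] fB.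
  (* In degree 0, y x is a boundary because y kills N, so y f(x) lies in B and y cancels modulo
     B. *)
  exists \0 => //= x; rewrite subr0; apply: regy.
  have [|u yx] := (pr_exact0 (p := P) (y *: x)).1.
    by rewrite linearZ /= ysN ?mem_head.
  by rewrite -linearZ /= yx.
have [h hP] := @resolution_homotopy _ _ P y i (ysN y (mem_head _ _)).
(* Since f is a cocycle modulo B, g d = y f modulo B. Hence g is a cocycle modulo B + yM, one degree
   lower, where the shorter sequence applies. *)
pose g : {linear pr_mod P i -> M} := f \o h.
have gE u : B (g (pr_d P i u) - y *: f u).
  have [|v vE] := (pr_exactS (p := P) (h (pr_d P i u) - y *: u)).1.
    by rewrite linearB linearZ /= hP subrr.
  by rewrite /g /= -linearZ -linearB /= vE.
have [] := IHi ys [set v | exists w, B (v - y *: w)] g => //.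
- by move=> z zys; apply: ysN; rewrite inE zys orbT.
- exact: submodule_preim_scale.
- by move=> u; exists (f u); apply: gE.
move=> e eC eB.
(* The values of g - e lie in B + yM; projectivity divides this map by y, modulo B. *)
have [|g' g'P] := projective_lift_mod (pr_proj (p := P) (n := i)) subB
                 (phi := y \*: idfun) (g := g \- e).
  move=> x; have [w] := eB x; exists w; rewrite /= -opprB; exact: submoduleN.
(* Modulo B, y f = g d = y [g'] d because e d = 0, and y cancels. *)
exists (g' \o pr_d P i) => [|u] /=; first by exists g'.
apply: regy; rewrite scalerBr -opprB -[X in B (- X)](subrKA (g (pr_d P i u))).
apply: submoduleN => //; apply: submoduleD => //.
by have := g'P (pr_d P i u); rewrite /= (coboundary_cocycle _ eC) subr0.
Qed.

End ExtVanishing.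

Lemma regular_sequence_mod (R : comPzRingType) (M : lmodType R) (xs : seq R) :
  regular_sequence M xs -> regular_mod [set 0 : M] xs.
Proof.
case=> reg _.
have -> : [set 0 : M] = smul [set` take 0 xs] [set: M].
  apply/seteqP; split=> [_ ->|]; first exact: submodule0 (submodule_smul _ _).
  by rewrite take0; apply: smul_sub submodule_set0 _ => a x; rewrite /= in_nil.
rewrite -[X in regular_mod _ X]drop0.
(* The induction is on the number k of remaining elements, since B grows as elements are used up. *)
suff H k : (k <= size xs)%N ->
  regular_mod (smul [set` take (size xs - k) xs] [set: M]) (drop (size xs - k) xs).
  by have := H (size xs) (leqnn _); rewrite subnn.
elim: k => [|k IHk] lek; first by rewrite subn0 drop_size.
have ltk : (size xs - k.+1 < size xs)%N by rewrite ltn_subrL (leq_trans _ lek).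
rewrite (drop_nth 0 ltk) -subSn // subSS; split; first exact: reg.
have -> : [set v : M | exists w,
    smul [set` take (size xs - k.+1) xs] setT (v - xs`_(size xs - k.+1) *: w)] =
    smul [set` take (size xs - k) xs] setT; last exact/IHk/ltnW.
apply/seteqP; rewrite -[in take (size xs - k)%N _]subSS subSn // (take_nth 0 ltk).
by split=> v; apply smul_rcons.
Qed.

Lemma Ext_eq0_regular (R : comPzRingType) (N M : lmodType R) (xs : seq R) i :
  regular_sequence M xs -> (forall y, y \in xs -> forall x : N, y *: x = 0) ->
  (i < size xs)%N -> Ext_eq0 i N M.
Proof.
move=> /regular_sequence_mod regM xsN lti P f fd.
have [//|b bC fb] := regular_mod_coboundary xsN lti submodule_set0 regM (f := f).
have E x : f x = b x by apply/eqP; rewrite -subr_eq0; apply/eqP/fb.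
move: bC E; clear fd fb lti; case: i f b => [|i] f b /= bC E.
  by move=> x; rewrite E.
by have [g gE] := bC; exists g => x; rewrite E.
Qed.

(** * Koszul complexes *)

Section LowDegree.
Variables (R : comPzRingType) (C : nat -> lmodType R).
Variable D : forall j, {linear C j -> C j.+1}.
Hypothesis C0 : forall x : C 0, x = 0.
Hypothesis DD : forall j (x : C j), D j.+1 (D j x) = 0.

Definition exact_at j := forall z : C j.+1, D j.+1 z = 0 -> exists y, z = D j y.

Variables (N : lmodType R) (P : proj_resolution N) (d : nat).
Hypothesis Ext_C : forall i j, (i < d)%N -> Ext_eq0 i N (C j).

(** This is the dimension shift: it says that Ext^i(N, C_(s+1) / im D_s) vanishes. Exactness embeds
    each such cokernel in the next term of C, which trades s for i. *)
Lemma coboundary_mod_boundary s i (f : {linear pr_mod P i -> C s.+1}) :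
  (i + s < d)%N -> (forall j, (j < s)%N -> exact_at j) ->
  (forall u, exists y, D s y = f (pr_d P i u)) ->
  exists2 b : {linear pr_mod P i -> C s.+1},
    coboundary b & forall u, exists y, f u - b u = D s y.
Proof.
elim: s i f => [|s IHs] i f ltd ex fD.
  (* For s = 0 the only boundary is 0, so f is an honest cocycle. *)
  exists f => [|u]; last by exists 0; rewrite linear0 subrr.
  apply: Ext_C; first by rewrite -[i]addn0.
  by move=> x; have [y <-] := fD x; rewrite (C0 y) linear0.
(* The lift g of f d is the connecting map: by exactness it is a cocycle modulo boundaries, in
   degree i + 1. *)
have [|g gP] := projective_lift (phi := D s.+1) (g := f \o pr_d P i)
                  (pr_proj (p := P) (n := i.+1)).
  exact: fD.
have [||u|b [e eE] bP] := IHs i.+1 g.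
- by rewrite addSnnS.
- by move=> j ltj; apply/ex/ltnW.
- have [|y ->] := ex s (ltnSn s) (g (pr_d P i.+1 u)); last by exists y.
  by rewrite gP /= pr_dd linear0.
(* As g = e d modulo boundaries and D D = 0, correcting f by D e makes it an honest cocycle. *)
pose h : {linear pr_mod P i -> C s.+2} := f \- (D s.+1 \o e).
exists h => [|u]; last by exists (e u); rewrite /h /= subKr.
apply: Ext_C => [|u]; first exact: leq_ltn_trans (leq_addr _ _) ltd.
have [y] := bP u; rewrite eE => yE.
by rewrite /h /= -[f _]gP -linearB yE DD.
Qed.

End LowDegree.

Lemma Ext_eq0_trivial (R : pzRingType) i (N V : lmodType R) :
  (forall v : V, v = 0) -> Ext_eq0 i N V.
Proof.
move=> V0 P f _; case: i f => [|i] f /=; first by move=> x; apply: V0.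
by exists \0 => x; rewrite [LHS]V0.
Qed.

Section LinearPair.
Variables (R : pzRingType) (U V W : lmodType R).
Variables (f : {linear U -> V}) (g : {linear U -> W}).

Definition linear_pair (u : U) : V * W := (f u, g u).

Lemma linear_pair_linear : linear linear_pair.
Proof. by move=> a u v; rewrite /linear_pair (linearP f) (linearP g). Qed.
HB.instance Definition _ :=
  GRing.isLinear.Build R U (V * W)%type *:%R linear_pair linear_pair_linear.

End LinearPair.

Lemma Ext_eq0_pair (R : pzRingType) i (N V W : lmodType R) :
  Ext_eq0 i N V -> Ext_eq0 i N W -> Ext_eq0 i N (V * W)%type.
Proof.
move=> ExtV ExtW P f fd.
have := ExtV P (fst \o f) (fun x => congr1 fst (fd x)).
have := ExtW P (snd \o f) (fun x => congr1 snd (fd x)).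
case: i f {fd ExtV ExtW} => [|i] f /=.
  by move=> f2 f1 x; rewrite [LHS]surjective_pairing f1 f2.
move=> [g2 g2E] [g1 g1E]; exists (linear_pair g1 g2) => x.
by rewrite [LHS]surjective_pairing g1E g2E.
Qed.

Lemma pair_ext (U V : Type) (u v : U * V) : u.1 = v.1 -> u.2 = v.2 -> u = v.
Proof. by case: u v => a b [c d] /= -> ->. Qed.

Section Koszul.
Variables (R : comPzRingType) (M : lmodType R) (x : nat -> R).

(* [koszul n j] is the term of cohomological degree j - 1, so that the zero
   term of degree -1 is part of the complex. *)
Fixpoint koszul (n j : nat) : lmodType R :=
  match n, j with
  | 0, 1 => M
  | n'.+1, j'.+1 => (koszul n' j'.+1 * koszul n' j')%type
  | _, _ => 'rV[R]_0
  end.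

(** The complex on n + 1 elements is the shifted cone of multiplication by x_n on the complex on n
    elements. *)
Fixpoint koszul_diff n : forall j, koszul n j -> koszul n j.+1 :=
  match n return forall j, koszul n j -> koszul n j.+1 with
  | 0 => fun _ _ => 0
  | n'.+1 => fun j =>
    match j return koszul n'.+1 j -> koszul n'.+1 j.+1 with
    | 0 => fun _ => 0
    | j'.+1 => fun w =>
        (koszul_diff w.1, x n' *: w.1 - koszul_diff w.2)
    end
  end.

Lemma koszul_diff_linear n j : linear (@koszul_diff n j).
Proof.
elim: n j => [|n IHn] [|j] a u v //=; rewrite ?scaler0 ?addr0 //.
congr pair; first exact: IHn.
rewrite /= IHn scalerDr scalerA mulrC -scalerA opprD addrACA.
by rewrite scalerBr.
Qed.
HB.instance Definition _ n j :=
  GRing.isLinear.Build R (koszul n j) (koszul n j.+1) *:%R (@koszul_diff n j)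
    (@koszul_diff_linear n j).

Definition koszul_d n j : {linear koszul n j -> koszul n j.+1} := @koszul_diff n j.

Lemma koszul_dS n j (a : koszul n j.+1) (b : koszul n j) :
  koszul_d n.+1 j.+1 (a, b) = (koszul_d n j.+1 a, x n *: a - koszul_d n j b).
Proof. by []. Qed.

Lemma koszul_dd n j (w : koszul n j) : koszul_d n j.+1 (koszul_d n j w) = 0.
Proof.
elim: n j w => [//|n IHn] [|j] w; first exact: linear0.
case: w => a b; rewrite !koszul_dS IHn linearB linearZ /= IHn.
by rewrite subr0 subrr.
Qed.

Lemma koszul_bot n (w : koszul n 0) : w = 0.
Proof. by case: n w => [|n] w; apply: thinmx0. Qed.

Lemma koszul_top n j (w : koszul n j) : (n.+1 < j)%N -> w = 0.
Proof.
elim: n j w => [|n IHn] [|[|j]] w //= ltj; first exact: thinmx0.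
by case: w => a b; rewrite (IHn _ a) ?(IHn _ b) // ltnW.
Qed.

(** Consequently every x_i with i < n kills the cohomology. *)
Lemma koszul_homotopy n i : (i < n)%N ->
  exists h : forall j, {linear koszul n j.+1 -> koszul n j},
    forall j (w : koszul n j.+1),
      x i *: w = koszul_d n j (h j w) + h j.+1 (koszul_d n j.+1 w).
Proof.
elim: n => // n IHn; rewrite ltnS leq_eqVlt => /predU1P[->|/IHn[h hP]].
  (* For the last element the homotopy is (a, b) -> (b, 0). *)
  exists (fun j => match j return {linear koszul n.+1 j.+1 -> koszul n.+1 j} with
    | 0 => \0
    | j'.+1 => linear_pair snd (\0 : {linear _ -> koszul n j'})
    end) => -[|j] [a b]; apply: pair_ext.
  - rewrite -[LHS]/(x n *: a) -[RHS]/(0 + (x n *: a - koszul_d n 0 b)).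
    by rewrite (koszul_bot b) linear0 subr0 add0r.
  - by rewrite [LHS]koszul_bot [RHS]koszul_bot.
  - rewrite -[LHS]/(x n *: a).
    rewrite -[RHS]/(koszul_d n j.+1 b + (x n *: a - koszul_d n j.+1 b)).
    by rewrite addrC subrK.
  rewrite -[LHS]/(x n *: b) -[RHS]/(x n *: b - koszul_d n j 0 + 0).
  by rewrite linear0 subr0 addr0.
(* For an earlier element the homotopy acts componentwise; its sign on the second factor makes the
   x_n terms cancel. *)
exists (fun j => match j return {linear koszul n.+1 j.+1 -> koszul n.+1 j} with
    | 0 => \0
    | j'.+1 => linear_pair (h j'.+1 \o fst) (\- (h j' \o snd))
    end) => -[|j] [a b]; apply: pair_ext.
- rewrite -[LHS]/(x i *: a) -[RHS]/(0 + h 1 (koszul_d n 1 a)).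
  by rewrite hP (koszul_bot (h 0 a)) linear0.
- by rewrite [LHS]koszul_bot [RHS]koszul_bot.
- exact: hP.
rewrite -[LHS]/(x i *: b).
rewrite -[RHS]/(x n *: h j.+1 a - koszul_d n j (- h j b)
                - h j.+1 (x n *: a - koszul_d n j.+1 b)).
rewrite linearN opprK (linearB (h j.+1)) (linearZ_LR (h j.+1)) opprB.
by rewrite [RHS]addrC subrKA addrC hP.
Qed.


Lemma Ext_eq0_koszul i (N : lmodType R) n j :
  Ext_eq0 i N M -> Ext_eq0 i N (koszul n j).
Proof.
move=> ExtM; elim: n j => [|n IHn] [|j].
- by apply: Ext_eq0_trivial => v; apply: thinmx0.
- by case: j => [//|j]; apply: Ext_eq0_trivial => v; apply: thinmx0.
- by apply: Ext_eq0_trivial => v; apply: thinmx0.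
- by apply: Ext_eq0_pair.
Qed.

(** The top term, of index n + 1 and so of cohomological degree n, is a single copy of M. *)
Fixpoint koszul_in n : M -> koszul n n.+1 :=
  match n return M -> koszul n n.+1 with
  | 0 => id
  | n'.+1 => fun v => (0, koszul_in n' v)
  end.

Lemma koszul_in_linear n : linear (koszul_in n).
Proof.
elim: n => // n IHn a u v; apply: pair_ext; last exact: IHn.
by rewrite -[LHS]/0 -[RHS]/(a *: 0 + 0) scaler0 addr0.
Qed.
HB.instance Definition _ n :=
  GRing.isLinear.Build R M (koszul n n.+1) *:%R (koszul_in n)
    (koszul_in_linear n).

Lemma koszul_in_onto n (w : koszul n n.+1) : exists v, koszul_in n v = w.
Proof.
elim: n w => [|n IHn] w; first by exists w.
have [v vE] := IHn w.2; exists v; apply: pair_ext => //.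
by rewrite (koszul_top w.1).
Qed.

(** Thus the top cohomology is M/(x_0, ..., x_(n-1))M. The last component of a boundary is x_n a - d
    b with a in the top term of the smaller complex, which matches [smul_rcons]. *)
Lemma koszul_boundary_in n (v : M) :
  (exists b, koszul_in n v = koszul_d n n b) <-> smul [set` mkseq x n] [set: M] v.
Proof.
elim: n v => [|n IHn] v.
  split=> [[b /= ->]|]; first exact: submodule0 (submodule_smul _ _).
  move=> v0; exists 0; rewrite linear0.
  by apply: smul_sub submodule_set0 _ v v0 => a u; rewrite /= in_nil.
rewrite mkseqS smul_rcons; split=> [[[a b] [_ vE]]|[w /IHn[b bE]]].
  have [w wE] := koszul_in_onto a; exists w; apply/IHn; exists (- b).
  by rewrite linearB linearZ /= wE [koszul_in n v]vE linearN [LHS]addrC addKr.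
exists (koszul_in n w, - b); apply: pair_ext.
  by rewrite -[LHS]/(0 : koszul n n.+2) [RHS]koszul_top.
rewrite -[LHS]/(koszul_in n v).
rewrite -[RHS]/(x n *: koszul_in n w - koszul_d n n (- b)) linearN opprK -bE.
by rewrite linearB linearZ /= addrC subrK.
Qed.

End Koszul.

(** * Removing elements from a Koszul complex, and regularity *)

Section KoszulRegular.
Variables (R : comPzRingType) (M : lmodType R) (x : nat -> R).

(* A substitute for a-adic completeness (derived completeness): the two
   conditions are the vanishing of Ext^i(R[1/a], V) for i = 1 and i = 0. *)
Definition telescopic (V : lmodType R) (a : R) : Prop :=
  (forall b : nat -> V, exists c, forall i, c i = b i + a *: c i.+1) /\
  (forall c : nat -> V, (forall i, c i = a *: c i.+1) -> c 0%N = 0).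

Lemma telescopic_trivial (V : lmodType R) a :
  (forall v : V, v = 0) -> telescopic V a.
Proof.
move=> V0; split=> [b|c _]; last exact: V0.
by exists b => i; rewrite [LHS]V0 [RHS]V0.
Qed.

Lemma telescopic_pair (V W : lmodType R) a :
  telescopic V a -> telescopic W a -> telescopic (V * W)%type a.
Proof.
move=> [exV unV] [exW unW]; split=> [b|c cE].
  have [c1 c1E] := exV (fst \o b); have [c2 c2E] := exW (snd \o b).
  by exists (fun i => (c1 i, c2 i)) => i; apply: pair_ext; [apply: c1E | apply: c2E].
apply: pair_ext; first by apply: (unV (fst \o c)) => i; rewrite /= {1}cE.
by apply: (unW (snd \o c)) => i; rewrite /= {1}cE.
Qed.

Lemma telescopic_koszul a n j : telescopic M a -> telescopic (koszul M n j) a.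
Proof.
move=> teleM; elim: n j => [|n IHn] [|j].
- by apply: telescopic_trivial => v; apply: thinmx0.
- by case: j => [//|j]; apply: telescopic_trivial => v; apply: thinmx0.
- by apply: telescopic_trivial => v; apply: thinmx0.
- by apply: telescopic_pair.
Qed.

(** In the long exact sequence of the cone, the hypothesis makes x_n surjective on H^j of the
    smaller complex; a derived form of Nakayama's lemma then makes H^j vanish. *)
Lemma koszul_exact_pred n j : telescopic M (x n) ->
  exact_at (koszul_d M x n.+1) j.+1 -> exact_at (koszul_d M x n) j.
Proof.
move=> tele ex z dz.
(* Exactness at (0, w) divides the class of w by x_n. *)
have step (w : koszul M n j.+1) : koszul_d M x n j.+1 w = 0 ->
    exists ab : koszul M n j.+1 * koszul M n j,
      w = x n *: ab.1 - koszul_d M x n j ab.2 /\ koszul_d M x n j.+1 ab.1 = 0.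
  move=> dw; have [|[a b] abE] := ex (0, w).
    by rewrite koszul_dS dw linear0 scaler0 subr0.
  move: abE; rewrite koszul_dS => -[da wE].
  by exists (a, b).
pose next (w : koszul M n j.+1) := xget (0, 0)
  [set ab : koszul M n j.+1 * koszul M n j |
    w = x n *: ab.1 - koszul_d M x n j ab.2 /\ koszul_d M x n j.+1 ab.1 = 0].
pose zs := fix zs i := if i is i'.+1 then (next (zs i')).1 else z.
have nextP w : koszul_d M x n j.+1 w = 0 ->
    w = x n *: (next w).1 - koszul_d M x n j (next w).2 /\
    koszul_d M x n j.+1 (next w).1 = 0.
  by move=> /step[ab abP]; rewrite /next; case: xgetP => [_ -> //|/(_ ab)].
have dzs i : koszul_d M x n j.+1 (zs i) = 0.
  by elim: i => //= i /nextP[].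
have [exs _] := telescopic_koszul n j tele.
have [_ uniq0] := telescopic_koszul n j.+1 tele.
(* Repeated division gives z_i = x_n z_(i+1) - d b_i. With c_i = b_i + x_n c_(i+1), the elements z_i
   + d c_i are x_n times their successors, so the first one is 0. *)
have [c cE] := exs (fun i => (next (zs i)).2).
exists (- c 0%N); rewrite linearN; apply/eqP; rewrite -addr_eq0; apply/eqP.
apply: (uniq0 (fun i => zs i + koszul_d M x n j (c i))) => i /=.
have [zE _] := nextP _ (dzs i).
rewrite {1}zE {1}cE linearD linearZ /= scalerDr -addrA; congr (_ + _).
by rewrite addKr.
Qed.

(** The hypothesis is the vanishing of H_1(x_0, ..., x_n; M). A relation x_n z = d b in the top term
    makes (z, b) a cocycle, and the first component of a preimage shows that z is a boundary. *)
Lemma koszul_exact_regular n z : exact_at (koszul_d M x n.+1) n ->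
  smul [set` mkseq x n] [set: M] (x n *: z) -> smul [set` mkseq x n] [set: M] z.
Proof.
move=> ex /koszul_boundary_in[b bE]; apply/koszul_boundary_in.
have [|w wE] := ex (koszul_in n z, b).
  rewrite koszul_dS -bE linearZ subrr; apply: pair_ext => //.
  exact: koszul_top.
(* For n = 0 the preimage w lies in the zero term of degree -1, which is not a product. *)
case: n b bE ex w wE => [|n] b bE ex w wE.
  by exists 0; rewrite [LHS](congr1 fst wE) (koszul_bot w) linear0 linear0.
by exists w.1; apply: (congr1 fst wE).
Qed.

End KoszulRegular.

(** * Ideals *)

Definition submodule_add_line (R : pzRingType) (M : lmodType R) (B : set M)
  (y : M) : set M := [set v | exists c, B (v - c *: y)].

Lemma submodule_add_lineP (R : pzRingType) (M : lmodType R) (B : set M)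
    (y : M) : submodule B -> submodule (submodule_add_line B y).
Proof.
move=> subB; split=> [|a u v [c cB] [d dB]].
  by exists 0; rewrite scale0r subr0; apply: submodule0.
exists (a * c + d); rewrite scalerDl -scalerA opprD addrACA -scalerBr.
exact: subB.2.
Qed.

Definition scale_at (R : pzRingType) (M : lmodType R) (v : M) (a : R^o) : M :=
  (a : R) *: v.

Lemma scale_at_linear (R : pzRingType) (M : lmodType R) (v : M) :
  linear (scale_at v).
Proof. by move=> a b c; rewrite /scale_at scalerDl -scalerA. Qed.
HB.instance Definition _ (R : pzRingType) (M : lmodType R) (v : M) :=
  GRing.isLinear.Build R R^o M *:%R (scale_at v) (scale_at_linear v).

(** With B = mN, the submodule W becomes a hyperplane of N/mN complementary to the line of a. *)
Lemma maximal_submodule_avoiding (R : pzRingType) (N : lmodType R)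
    (B : set N) (a : N) : submodule B -> ~ B a ->
  exists W : set N, [/\ submodule W, B `<=` W, ~ W a &
    forall W', submodule W' -> W `<=` W' -> ~ W' a -> W' = W].
Proof.
move=> subB Ba.
(* The empty set is let in because Zorn_bigcup also takes the union of the
   empty chain. *)
have [F FP totF|W [WP Wmax]] := @Zorn_bigcup N
    [set W | W = set0 \/ [/\ submodule W, B `<=` W & ~ W a]].
  have [[W0 [FW0 [w W0w]]]|noF] := pselect (exists W, F W /\ W !=set0); last first.
    left; apply/seteqP; split=> // v [W FW Wv]; apply: noF; exists W.
    by split=> //; exists v.
  right; have FS W v : F W -> W v -> [/\ submodule W, B `<=` W & ~ W a].
    by move=> /FP[->|].
  split.
  - split; first by exists W0 => //; have [[]] := FS _ _ FW0 W0w.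
    move=> c u v [U FU Uu] [V FV Vv].
    have [UV|VU] := totF _ _ FU FV.
      exists V => //; have [sub _ _] := FS _ _ FV Vv.
      by apply: sub.2 => //; apply: UV.
    exists U => //; have [sub _ _] := FS _ _ FU Uu.
    by apply: sub.2 => //; apply: VU.
  - by move=> v Bv; exists W0 => //; have [_ /(_ _ Bv)] := FS _ _ FW0 W0w.
  - by move=> [W FW Wa]; have [] := FS _ _ FW Wa.
have [W0|[subW BW Wa]] := WP.
  have [|] := Wmax B; last by right; split.
  by rewrite W0; split=> // /(_ 0 (submodule0 subB)).
exists W; split=> // W' subW' WW' W'a; apply: contrapT => neW.
apply: (Wmax W'); last by right; split=> // v /BW/WW'.
by split=> // W'W; apply: neW; apply/seteqP.
Qed.

Section Ideals.
Variable R : comPzRingType.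

Lemma mem_ideal0 (I : set R) : is_ideal I -> I 0.
Proof. exact: (@submodule0 R R^o). Qed.

Lemma mem_idealMl (I : set R) a b : is_ideal I -> I b -> I (a * b).
Proof. by move=> idI; apply: (@submoduleZ R R^o I idI). Qed.

Lemma mem_idealMr (I : set R) a b : is_ideal I -> I a -> I (a * b).
Proof. by rewrite mulrC; apply: mem_idealMl. Qed.

Lemma mem_idealD (I : set R) a b : is_ideal I -> I a -> I b -> I (a + b).
Proof. by move=> idI; apply: (@submoduleD R R^o I idI). Qed.

Lemma mem_idealN (I : set R) a : is_ideal I -> I a -> I (- a).
Proof. by move=> idI; apply: (@submoduleN R R^o I idI). Qed.

Lemma mem_idealB (I : set R) a b : is_ideal I -> I a -> I b -> I (a - b).
Proof. by move=> idI; apply: (@submoduleB R R^o I idI). Qed.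

Lemma mem_idealBr (I : set R) a b : is_ideal I -> I (a - b) -> I b -> I a.
Proof. by move=> idI; apply: (@submoduleBr R R^o I idI). Qed.

Lemma ideal_gen_sub (S I : set R) : is_ideal I -> S `<=` I -> ideal_gen S `<=` I.
Proof. exact: (@span_sub R R^o S I). Qed.

Lemma sub_ideal_gen (S : set R) : S `<=` ideal_gen S.
Proof. exact: (@subset_span R R^o S). Qed.

Lemma is_ideal_gen (S : set R) : is_ideal (ideal_gen S).
Proof. exact: (@submodule_span R R^o). Qed.

Definition ideal_add (I : set R) (y : R) : set R := @submodule_add_line R R^o I y.

Lemma is_ideal_add I y : is_ideal I -> is_ideal (ideal_add I y).
Proof. exact: (@submodule_add_lineP R R^o). Qed.

Lemma ideal_add_sub I y : is_ideal I -> I `<=` ideal_add I y.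
Proof. by move=> idI a Ia; exists 0; rewrite scale0r subr0. Qed.

Lemma ideal_add_mem I y : is_ideal I -> ideal_add I y y.
Proof. by move=> idI; exists 1; rewrite scale1r subrr; apply: mem_ideal0. Qed.

Lemma maximal_inverse (m : set R) r : maximal_ideal m -> ~ m r ->
  exists s, m (1 - s * r).
Proof.
move=> [idm m1 mmax] mr; apply: contrapT => nos; apply: mr.
rewrite -(mmax (ideal_add m r)) //.
- exact: ideal_add_mem.
- exact: is_ideal_add.
- exact: ideal_add_sub.
Qed.

Lemma maximal_prime (m : set R) : maximal_ideal m -> prime_ideal m.
Proof.
move=> maxm; have [idm m1 _] := maxm; split=> // a b mab.
have [ma|ma] := pselect (m a); [by left | right].
have [s ms] := maximal_inverse maxm ma.
apply: (mem_idealBr idm (b := s * (a * b))); last exact: mem_idealMl.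
by rewrite mulrA -{1}[b]mul1r -mulrBl; apply: mem_idealMr.
Qed.

Lemma prime_expr (P : set R) a n : prime_ideal P -> P (a ^+ n) -> P a.
Proof.
move=> [idP P1 PM]; elim: n => [|n IHn]; first by rewrite expr0.
by rewrite exprS => /PM[].
Qed.

Lemma radical_sub_prime (I P : set R) : prime_ideal P -> I `<=` P -> radical I `<=` P.
Proof. by move=> primeP IP a [n /IP]; apply: prime_expr. Qed.

(* A chain of ideals has a finitely generated union, so the union belongs to
   the chain. *)
Lemma noetherian_maximal (F : set (set R)) : noetherian R ->
  (forall I, F I -> is_ideal I) -> F !=set0 ->
  exists I, F I /\ forall J, F J -> I `<=` J -> J = I.
Proof.
move=> noeth Fid [I0 FI0].
have [G GP totG|W [WP Wmax]] := @Zorn_bigcup R [set I | I = set0 \/ F I].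
  set U := \bigcup_(X in G) X.
  have [[W0 [GW0 [w W0w]]]|noG] := pselect (exists W, G W /\ W !=set0); last first.
    left; apply/seteqP; split=> // v [W GW Wv]; apply: noG; exists W.
    by split=> //; exists v.
  right; have GF W v : G W -> W v -> F W by move=> /GP[->|].
  have Gid W v : G W -> W v -> is_ideal W by move=> GW /(GF _ _ GW); apply: Fid.
  have idU : is_ideal U.
    split; first by exists W0 => //; apply: mem_ideal0; apply: Gid W0w.
    move=> c u v [I GI Iu] [J GJ Jv].
    have [IJ|JI] := totG _ _ GI GJ.
      by exists J => //; apply: (Gid _ _ GJ Jv).2 => //; apply: IJ.
    by exists I => //; apply: (Gid _ _ GI Iu).2 => //; apply: JI.
  have [s sE] := noeth U idU.
  have sU : [set` s] `<=` U by rewrite sE; apply: sub_ideal_gen.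
  have [W [GW W_neq0 sW]] : exists W, [/\ G W, W !=set0 & [set` s] `<=` W].
    elim: s sU {sE} => [|a s IHs] sU; first by exists W0; split=> //; exists w.
    have [|W [GW [v Wv] sW]] := IHs.
      by move=> b sb; apply: sU; rewrite /= inE sb orbT.
    have [|V GV Va] := sU a; first by rewrite /= mem_head.
    have [VW|WV] := totG _ _ GV GW.
      exists W; split=> //; first by exists v.
      by move=> b; rewrite /= inE => /predU1P[->|/sW//]; apply: VW.
    exists V; split=> //; first by exists a.
    by move=> b; rewrite /= inE => /predU1P[->//|/sW/WV].
  have [v Wv] := W_neq0.
  suff -> : U = W by apply: GF Wv.
  apply/seteqP; split; first by rewrite sE; apply: ideal_gen_sub => //; apply: Gid Wv.
  by move=> b Wb; exists W.
have [W0|FW] := WP.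
  have [|] := Wmax I0; last by right.
  rewrite W0; split=> // /(_ 0 (mem_ideal0 (Fid _ FI0))).
  by [].
exists W; split=> // J FJ WJ; apply: contrapT => neJ.
apply: (Wmax J); last by right.
by split=> // JW; apply: neJ; apply/seteqP.
Qed.

End Ideals.

(** Among the annihilators of the nonzero multiples of z modulo B take a maximal one. It is prime
    and contains I, hence contains the radical m of I. *)
Lemma socle_element (R : comPzRingType) (V : lmodType R) (m I : set R)
    (B : set V) (z : V) : noetherian R -> maximal_ideal m -> radical I = m ->
  submodule B -> ~ B z -> (forall a, I a -> B (a *: z)) ->
  exists r, ~ B (r *: z) /\ forall a, m a -> B (a *: (r *: z)).
Proof.
move=> noeth [idm m1 mmax] radI subB Bz IB.
pose F : set (set R) := [set J | exists2 r, ~ B (r *: z) &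
  J = [set a | B (a *: (r *: z))]].
have Fid J : F J -> is_ideal J.
  move=> [r _ ->]; split; first by rewrite /= scale0r; apply: submodule0.
  by move=> a b c /= Bb Bc; rewrite scalerDl -scalerA; apply: subB.2.
have [|J [[r Br JE] Jmax]] := noetherian_maximal noeth Fid.
  by exists [set a | B (a *: (1 *: z))]; exists 1; rewrite ?scale1r.
exists r; split=> // a ma; rewrite -[B _]/([set a | B (a *: (r *: z))] a) -JE.
have J1 : ~ J 1 by rewrite JE /= scale1r.
have primeJ : prime_ideal J.
  split=> // [|b c Jbc]; first by apply: Fid; exists r.
  have [Jc|Jc] := pselect (J c); [by right | left].
  rewrite -(Jmax [set a | B (a *: ((c * r) *: z))]).
  - by move: Jbc; rewrite JE /= !scalerA mulrA.
  - by exists (c * r) => //; move: Jc; rewrite JE /= scalerA.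
  - move=> e; rewrite JE /= => Be.
    by rewrite -scalerA [e *: _]scalerA mulrC -scalerA; apply: submoduleZ.
suff mJ : m `<=` J by exact: mJ ma.
rewrite -radI; apply: radical_sub_prime => // b Ib.
by rewrite JE /= scalerA mulrC -scalerA; apply: submoduleZ (IB _ Ib).
Qed.

(* A linear functional on N/mN that is 1 at the image of u0, lifted to P. *)
Lemma functional_mod_maximal (R : comPzRingType) (m : set R) (N P : lmodType R)
    (pi : {linear P -> N}) : maximal_ideal m -> projective P ->
  (forall y, exists u, pi u = y) -> smul m [set: N] <> setT ->
  exists (l : {linear P -> R^o}) (u0 : P),
    m (1 - l u0) /\ forall u, pi u = 0 -> m (l u).
Proof.
move=> maxm projP pi_surj mN; have [idm m1 mmax] := maxm.
have [a mNa] : exists a, ~ smul m [set: N] a.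
  apply: contrapT => noa; apply: mN; apply/seteqP; split=> // a _.
  by apply: contrapT => mNa; apply: noa; exists a.
have [W [subW mNW Wa Wmax]] :=
  maximal_submodule_avoiding (submodule_smul _ _) mNa.
have mW b v : m b -> W (b *: v) by move=> mb; exact: mNW _ (smulZ mb _).
have coefm r : W (r *: a) -> m r.
  move=> Wra; apply: contrapT => /(maximal_inverse maxm)[s ms]; apply: Wa.
  apply: (submoduleBr subW (y := s *: (r *: a))); last exact: submoduleZ.
  by rewrite scalerA -{1}[a]scale1r -scalerBl; apply: mW.
(* If y is not in W, maximality gives a = r y modulo W. Here r is outside m because a is outside W,
   and an inverse s of r modulo m gives s a = y modulo W. *)
have coef y : exists r, W (r *: a - y).
  have [Wy|Wy] := pselect (W y).
    by exists 0; rewrite scale0r sub0r; apply: submoduleN.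
  have [r ra] : submodule_add_line W y a.
    apply: contrapT => /(Wmax _ (submodule_add_lineP y subW)) WE.
    apply: Wy; rewrite -WE; first by exists 1; rewrite scale1r subrr; apply: submodule0.
    by move=> v Wv; exists 0; rewrite scale0r subr0.
  have [|s ms] := maximal_inverse maxm (r := r).
    move=> mr; apply: Wa; apply: (submoduleBr subW ra); exact: mW.
  exists s; apply: (submoduleBr subW (y := (s * r - 1) *: y)); last first.
    by apply: mW; rewrite -opprB; apply: mem_idealN.
  rewrite scalerBl scale1r opprB addrA subrK -scalerA -scalerBr.
  exact: submoduleZ.
have [u|l lP] := projective_lift_mod projP subW (phi := scale_at a) (g := pi).
  exact: coef.
have [u0 u0E] := pi_surj a; exists l, u0; split=> [|u pu0].
  apply: coefm; rewrite scalerBl scale1r -opprB -[in X in _ - X]u0E.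
  exact/(submoduleN subW)/lP.
by apply: coefm; have := lP u; rewrite pu0 subr0.
Qed.

(** * From vanishing of Ext to regular sequences *)

Section Completeness.
Variables (R : comPzRingType) (m : set R) (M : lmodType R).

Lemma submodule_adic n : submodule (@adic_filtration R m M n).
Proof. by case: n => [|n]; [apply: submodule_setT | apply: submodule_smul]. Qed.

Lemma adic_filtrationX a n v : m a -> @adic_filtration R m M n (a ^+ n *: v).
Proof.
by move=> ma; elim: n => // n IHn; rewrite exprS -scalerA; apply: smulZ.
Qed.

Hypothesis M_complete : adically_complete m M.

(** The solution is c_i = \sum_k a^k b_(i+k), which converges because a^k M lies in m^k M. In the
    homogeneous case c_0 = a^n c_n lies in every m^n M. *)
Lemma complete_telescopic a : m a -> telescopic M a.
Proof.
have [sep lim] := M_complete => ma.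
split=> [b|c cE]; last first.
  apply: sep => n; suff -> : c 0%N = a ^+ n *: c n by apply: adic_filtrationX.
  elim: n => [|n IHn]; first by rewrite expr0 scale1r.
  by rewrite IHn {1}cE scalerA -exprSr.
pose u i n := \sum_(k < n) a ^+ k *: b (i + k)%N.
have uS i n : u i n.+1 - u i n = a ^+ n *: b (i + n)%N.
  by rewrite /u big_ord_recr /= [LHS]addrC addKr.
have ulim i : exists l, forall n, @adic_filtration R m M n (u i n - l).
  by apply: lim => n; rewrite uS; apply: adic_filtrationX.
have [l lP] := choice ulim; exists l => i.
have uE n : u i n.+1 = b i + a *: u i.+1 n.
  rewrite /u big_ord_recl expr0 scale1r addn0 scaler_sumr; congr (_ + _).
  by apply: eq_bigr => k _; rewrite scalerA -exprS /bump /= addSnnS.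
apply/eqP; rewrite -subr_eq0; apply/eqP/sep => -[//|n].
rewrite -[l i - _](subrKA (u i n.+1)); apply: (submoduleD (submodule_adic _)).
  by rewrite -opprB; apply: (submoduleN (submodule_adic _)); apply: lP.
by rewrite uE opprD addrACA subrr add0r -scalerBr; apply: smulZ => //; apply: lP.
Qed.

(** If mM = M then every m^n M is M, and separatedness forces M = 0. *)
Lemma complete_smul_neq : (exists x : M, x <> 0) -> smul m [set: M] <> setT.
Proof.
move=> [v v0] mM; apply/v0/M_complete.1 => n.
suff -> : @adic_filtration R m M n = setT by [].
by elim: n => //= n ->.
Qed.

End Completeness.

(** * Koszul exactness from vanishing of Ext *)

Section Converse.
Variables (R : comNzRingType) (m : set R) (M N : lmodType R).
Hypotheses (R_noeth : noetherian R) (m_max : maximal_ideal m).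
Variables (x : nat -> R) (d : nat).
Hypothesis x_rad : radical (ideal_gen [set` mkseq x d]) = m.
Hypothesis mN : smul m [set: N] <> setT.
Hypothesis Ext_NM : forall i, (i < d)%N -> Ext_eq0 i N M.

Lemma koszul_exact s : (s < d)%N -> exact_at (koszul_d M x d) s.
Proof.
elim/ltn_ind: s => s IHs ltd z dz; apply: contrapT => zB.
have [P] := proj_resolution_exists N.
pose B : set (koszul M d s.+1) := [set w | exists y, w = koszul_d M x d s y].
have subB : submodule B.
  split=> [|a u v [u' ->] [v' ->]]; first by exists 0; rewrite linear0.
  by exists (a *: u' + v'); rewrite linearP.
have xB (w : koszul M d s.+1) i : koszul_d M x d s.+1 w = 0 -> (i < d)%N ->
    B (x i *: w).
  move=> dw lti; have [h hP] := koszul_homotopy M x lti.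
  by exists (h s w); rewrite hP dw linear0 addr0.
have IB a : ideal_gen [set` mkseq x d] a -> B (a *: z).
  have subI : @submodule R R^o [set a : R | B (a *: z)].
    split=> [|b u v /= Bu Bv]; first by rewrite /= scale0r; apply: submodule0.
    by rewrite scalerDl -scalerA; apply: subB.2.
  apply: (ideal_gen_sub subI) => b /mapP[i]; rewrite mem_iota => /andP[_ lti] ->.
  exact: xB.
have [r [rzB mrB]] := socle_element R_noeth m_max x_rad subB zB IB.
have [l [u0 [lu0 lm]]] := functional_mod_maximal m_max (pr_proj (p := P) (n := 0%N))
  (pr_aug_surj P) mN.
(* Modulo boundaries, f is the map N -> k -> H^s that sends 1 in k to the class of r z. *)
pose f : {linear pr_mod P 0 -> koszul M d s.+1} := scale_at (r *: z) \o l.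
have C0 := @koszul_bot R M d.
have DD j (w : koszul M d j) : koszul_d M x d j.+1 (koszul_d M x d j w) = 0.
  exact: koszul_dd.
have ExtC i j : (i < d)%N -> Ext_eq0 i N (koszul M d j).
  by move=> lti; apply/Ext_eq0_koszul/Ext_NM.
have [|j ltj|u|b b0 fB] := coboundary_mod_boundary C0 DD ExtC (f := f) (s := s).
- by rewrite add0n.
- by apply: IHs => //; apply: ltn_trans ltd.
- have [|y yE] := mrB (l (pr_d P 0 u)); last by exists y.
  by apply/lm/pr_exact0; exists u.
(* In degree 0 a coboundary is zero, so f takes values in boundaries. Since 1 - l(u0) is in m, which
   kills r z modulo boundaries, r z agrees with f(u0) there. *)
apply: rzB; apply: (submoduleBr subB (y := f u0)); last first.
  by have [y] := fB u0; rewrite b0 subr0 => ->; exists y.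
have [y yE] := mrB _ lu0; exists y; rewrite -yE.
by rewrite scalerBl scale1r.
Qed.

(** This degree is one below the top, where the cohomology is H_1(x_0, ..., x_n; M). Descend from n
    = d - 1: each removal lowers the number of elements and the degree together. *)
Lemma koszul_exact_diag n : (forall i, (i < d)%N -> telescopic M (x i)) ->
  (n < d)%N -> exact_at (koszul_d M x n.+1) n.
Proof.
move=> tele ltn.
suff H k : (k <= d.-1)%N -> exact_at (koszul_d M x (d.-1 - k).+1) (d.-1 - k).
  have := H (d.-1 - n)%N (leq_subr _ _); rewrite subKn //.
  by rewrite -ltnS prednK // (leq_trans _ ltn).
have d_gt0 : (0 < d)%N by apply: leq_trans ltn.
elim: k => [|k IHk] lek.
  by rewrite subn0 prednK //; apply: koszul_exact; rewrite ltn_predL.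
have E : (d.-1 - k = (d.-1 - k.+1).+1)%N by rewrite subnSK.
apply: koszul_exact_pred; last by rewrite -E; apply/IHk/ltnW.
by apply: tele; rewrite -E -[ltnRHS]prednK // ltnS leq_subr.
Qed.

End Converse.

Theorem Ext_eq0_balanced (R : comNzRingType) (m : set R) (M N : lmodType R) :
  noetherian R -> maximal_ideal m -> (exists x : M, x <> 0) ->
  adically_complete m M -> smul m [set: N] <> setT ->
  (forall i, (i < krull_dim R)%N -> Ext_eq0 i N M) -> balanced_bigCM m M.
Proof.
move=> noeth maxm M0 complM mN ExtNM.
have mM := complete_smul_neq complM M0; split=> // xs [sz rad].
have xsE : mkseq (nth 0 xs) (krull_dim R) = xs by rewrite -sz mkseq_nth.
have xsm : [set` xs] `<=` m.
  by move=> a xsa; rewrite -rad; exists 1%N; rewrite expr1; apply: sub_ideal_gen.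
split; last first.
  by move=> xsM; apply: mM; apply/seteqP; split=> // v _; apply: (smulS xsm); rewrite xsM.
move=> i lti; have takeE : take i xs = mkseq (nth 0 xs) i.
  by rewrite -{1}xsE /mkseq -map_take take_iota (minn_idPl _) // -sz ltnW.
rewrite takeE => N' z; apply: koszul_exact_regular.
apply: (@koszul_exact_diag _ m _ N _ _ _ (krull_dim R)) => //.
- by rewrite xsE.
- by move=> j ltj; apply: (complete_telescopic complM); apply/xsm/mem_nth; rewrite sz.
- by rewrite -sz.
Qed.

(** * Existence of systems of parameters *)

Section Dimension.
Variable R : comPzRingType.

(** Noetherian induction: a maximal counterexample I is proper and not prime, so it contains some ab
    with a and b outside I. Every prime over I then lies over I + (a) or I + (b), whose lists can be
    joined. *)
Lemma noetherian_primes_over (J : set R) : noetherian R -> is_ideal J ->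
  exists Qs : seq (set R),
    (forall Q, Q \in Qs -> prime_ideal Q /\ J `<=` Q) /\
    (forall P, prime_ideal P -> J `<=` P -> exists2 Q, Q \in Qs & Q `<=` P).
Proof.
move=> noeth idJ; apply: contrapT => noQs.
pose good (J : set R) := exists Qs : seq (set R),
    (forall Q, Q \in Qs -> prime_ideal Q /\ J `<=` Q) /\
    (forall P, prime_ideal P -> J `<=` P -> exists2 Q, Q \in Qs & Q `<=` P).
have [|I [[idI badI] Imax]] := @noetherian_maximal _
    [set J | is_ideal J /\ ~ good J] noeth (fun I FI => FI.1).
  by exists J.
apply: badI.
have [I1|I1] := pselect (I 1).
  by exists [::]; split=> // P [_ P1 _] /(_ 1 I1).
have [primeI|nprime] := pselect (prime_ideal I).
  exists [:: I]; split=> [Q|P _ IP]; first by rewrite inE => /eqP->; split.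
  by exists I; rewrite ?mem_head.
have [a [b [Iab Ia Ib]]] : exists a b, [/\ I (a * b), ~ I a & ~ I b].
  apply: contrapT => noab; apply: nprime; split=> // a b Iab.
  apply: contrapT => nIab; apply: noab; exists a, b.
  by split=> // Ic; apply: nIab; [left | right].
have add_good c : ~ I c -> good (ideal_add I c).
  move=> Ic; apply: contrapT => bad; apply: Ic.
  rewrite -(Imax (ideal_add I c)); first exact: ideal_add_mem.
    by split=> //; apply: is_ideal_add.
  exact: ideal_add_sub.
have addP c P : is_ideal P -> I `<=` P -> P c -> ideal_add I c `<=` P.
  move=> idP IP Pc d [e] /IP Pdec; apply: (mem_idealBr idP Pdec).
  exact: (mem_idealMl e idP Pc).
have [Qa [Qa_prime QaP]] := add_good a Ia.
have [Qb [Qb_prime QbP]] := add_good b Ib.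
exists (Qa ++ Qb); split=> [Q|P primeP IP].
  rewrite mem_cat => /orP[/Qa_prime|/Qb_prime] [primeQ IQ]; split=> //.
    by move=> c /(ideal_add_sub a idI)/IQ.
  by move=> c /(ideal_add_sub b idI)/IQ.
have [idP _ PM] := primeP.
have [Pa|Pb] := PM a b (IP _ Iab).
  have [|Q QQa QP] := QaP P primeP; first exact: addP.
  by exists Q; rewrite // mem_cat QQa.
have [|Q QQb QP] := QbP P primeP; first exact: addP.
by exists Q; rewrite // mem_cat QQb orbT.
Qed.

Lemma prime_avoidance (I : set R) (Qs : seq (set R)) : is_ideal I ->
  (forall Q, Q \in Qs -> prime_ideal Q /\ ~ I `<=` Q) ->
  exists2 y, I y & forall Q, Q \in Qs -> ~ Q y.
Proof.
move=> idI; elim: Qs => [|Q Qs IHQs] QsP; first by exists 0; [apply: mem_ideal0 |].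
have [|y Iy yQs] := IHQs.
  by move=> Q' Q'Qs; apply: QsP; rewrite inE Q'Qs orbT.
have [Qy|Qy] := pselect (Q y); last first.
  by exists y => // Q'; rewrite inE => /predU1P[->//|]; apply: yQs.
have [primeQ IQ] := QsP Q (mem_head _ _); have [idQ Q1 QM] := primeQ.
(* y + w avoids the members of Qs inside Q because Q does not contain it, and
   the others because they contain w but not y. *)
have [w [Iw Qw wQs]] : exists w, [/\ I w, ~ Q w &
    forall Q', Q' \in Qs -> ~ Q' `<=` Q -> Q' w].
  (* Start from an element of I outside Q and multiply it by an element outside Q of each such [Q'];
     primality keeps the product outside Q. *)
  elim: Qs QsP {IHQs yQs} => [|Q' Qs IHQs] QsP.
    apply: contrapT => now; apply: IQ => w Iw; apply: contrapT => Qw.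
    by apply: now; exists w.
  have [|w [Iw Qw wQs]] := IHQs.
    move=> Q''; rewrite inE => /predU1P[->|Q''Qs]; apply: QsP.
      by rewrite mem_head.
    by rewrite !inE Q''Qs !orbT.
  have [[idQ' _ _] _] : prime_ideal Q' /\ ~ I `<=` Q'.
    by apply: QsP; rewrite !inE eqxx orbT.
  have [Q'Q|Q'Q] := pselect (Q' `<=` Q).
    by exists w; split=> // Q''; rewrite inE => /predU1P[->//|]; apply: wQs.
  have [v Q'v Qv] : exists2 v, Q' v & ~ Q v.
    apply: contrapT => nov; apply: Q'Q => v Q'v; apply: contrapT => Qv.
    by apply: nov; exists v.
  exists (v * w); split=> [||Q'']; first exact: mem_idealMl; first by move=> /QM[].
  rewrite inE => /predU1P[-> _|Q''Qs Q''Q].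
    exact: mem_idealMr.
  have [[idQ'' _ _] _] : prime_ideal Q'' /\ ~ I `<=` Q''.
    by apply: QsP; rewrite !inE Q''Qs !orbT.
  by apply: mem_idealMl => //; apply: wQs.
have Qyw : ~ Q (y + w).
  move=> Qyw; apply: Qw; rewrite -(addKr y w).
  by apply: mem_idealD => //; apply: mem_idealN.
exists (y + w); first exact: mem_idealD.
move=> Q'; rewrite inE => /predU1P[->//|Q'Qs].
have [Q'Q|Q'Q] := pselect (Q' `<=` Q); first by move=> /Q'Q.
have [[idQ' _ _] _] : prime_ideal Q' /\ ~ I `<=` Q'.
  by apply: QsP; rewrite inE Q'Qs orbT.
move=> Q'yw; apply: (yQs _ Q'Qs); rewrite -(addrK w y).
by apply: mem_idealB => //; apply: wQs.
Qed.

(** An ideal maximal among those that contain I and no power of a is prime. *)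
Lemma noetherian_radical (I : set R) a : noetherian R -> is_ideal I ->
  ~ radical I a -> exists P, [/\ prime_ideal P, I `<=` P & ~ P a].
Proof.
move=> noeth idI nIa.
have [||P [[idP IP Pa] Pmax]] := @noetherian_maximal _
    [set J | [/\ is_ideal J, I `<=` J & forall n, ~ J (a ^+ n)]] noeth.
- by move=> J [].
- by exists I; split=> // n Ian; apply: nIa; exists n.
have power c : ~ P c -> exists n, ideal_add P c (a ^+ n).
  move=> Pc; apply: contrapT => non; apply: Pc.
  rewrite -(Pmax (ideal_add P c)); first exact: ideal_add_mem.
    split; first exact: is_ideal_add.
      by move=> b /IP; apply: ideal_add_sub.
    by move=> n an; apply: non; exists n.
  exact: ideal_add_sub.
exists P; split=> //; last by have := Pa 1%N; rewrite expr1.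
split=> //; first by have := Pa 0%N; rewrite expr0.
move=> b c Pbc; apply: contrapT => nP.
have [|k [e ke]] := power b; first by move=> Pb; apply: nP; left.
have [|l [f lf]] := power c; first by move=> Pc; apply: nP; right.
apply: (Pa (k + l)%N); rewrite exprD.
(* Modulo P, a^k is e b and a^l is f c, so each of the three summands lies in P. *)
have -> : a ^+ k * a ^+ l = (a ^+ k - e * b) * a ^+ l
                           + (e * b * (a ^+ l - f * c) + e * f * (b * c)).
  by rewrite mulrBl mulrBr [e * b * (f * c)]mulrACA subrK subrK.
apply: mem_idealD => //; first exact: mem_idealMr.
by apply: mem_idealD => //; apply: mem_idealMl.
Qed.

Lemma local_sub (m J : set R) : noetherian R -> local_ring m -> is_ideal J ->
  ~ J 1 -> J `<=` m.
Proof.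
move=> noeth [_ mP] idJ J1.
have [||n [[idn Jn n1] nmax]] := @noetherian_maximal _
    [set n | [/\ is_ideal n, J `<=` n & ~ n 1]] noeth.
- by move=> n [].
- by exists J; split.
rewrite -(mP n) //; split=> // K idK nK K1; apply: nmax => //.
by split=> // a /Jn/nK.
Qed.

(** Each new parameter avoids the listed primes other than m over the previous ones, which lowers by
    one the bound on chains of primes over the ideal. *)
Lemma sop_exists (m : set R) d : noetherian R -> local_ring m ->
  (forall n, prime_chain R n -> (n <= d)%N) ->
  exists2 xs : seq R, size xs = d & radical (ideal_gen [set` xs]) = m.
Proof.
move=> noeth locm dmax; have [maxm _] := locm; have [idm m1 mmax] := maxm.
pose chain_over (I : set R) n := exists P : nat -> set R,
  [/\ forall i, (i <= n)%N -> prime_ideal (P i),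
      forall i, (i < n)%N -> P i `<` P i.+1 & I `<=` P 0%N].
have consP I (P : set R) (Q : nat -> set R) n : prime_ideal P -> I `<=` P ->
    P `<` Q 0%N -> (forall i, (i <= n)%N -> prime_ideal (Q i)) ->
    (forall i, (i < n)%N -> Q i `<` Q i.+1) -> chain_over I n.+1.
  move=> primeP IP PQ primeQ QQ; exists (fun i => if i is i'.+1 then Q i' else P).
  by split=> // -[|i] //; [apply: primeQ | apply: QQ].
suff H j : (j <= d)%N -> exists xs : seq R, [/\ size xs = j, [set` xs] `<=` m &
    forall n, chain_over (ideal_gen [set` xs]) n -> (n + j <= d)%N].
  have [xs [sz xsm bound]] := H d (leqnn d); exists xs => //.
  apply/seteqP; split.
    by apply: radical_sub_prime; [apply: maximal_prime | apply: ideal_gen_sub].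
  move=> a ma; apply: contrapT => /(noetherian_radical noeth (is_ideal_gen _)).
  move=> [P [primeP xsP Pa]]; have [idP P1 _] := primeP.
  (* After d steps chains over the ideal have length 0, but a prime P over it that misses a would
     give the chain P < m. *)
  suff /bound : chain_over (ideal_gen [set` xs]) 1 by rewrite addSn ltnn.
  apply: (@consP _ P (fun=> m)) => //; last by move=> i _; apply: maximal_prime.
  by split; [apply: (local_sub noeth locm) | move/(_ _ ma)].
elim: j => [_|j IHj ltj].
  exists [::]; split=> // n [P [primeP PP _]]; rewrite addn0; apply: dmax.
  by exists P.
have [xs [sz xsm bound]] := IHj (ltnW ltj).
have [Qs [Qs_prime QsP]] := noetherian_primes_over noeth (is_ideal_gen [set` xs]).
have [|y my yQs] := prime_avoidance (Qs := [seq Q <- Qs | Q != m]) idm.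
  move=> Q; rewrite mem_filter => /andP[/eqP Qm /Qs_prime[primeQ _]]; split=> // mQ.
  by apply: Qm; apply: mmax => //; have [] := primeQ.
exists (rcons xs y); split.
- by rewrite size_rcons sz.
- by move=> a /=; rewrite mem_rcons inE => /predU1P[->|/xsm].
move=> n [P [primeP PP xsyP]].
have xsP : ideal_gen [set` xs] `<=` P 0%N.
  apply: ideal_gen_sub; first by have [] := primeP 0%N.
  move=> a xsa; apply: xsyP; apply: sub_ideal_gen.
  by rewrite /= mem_rcons inE [a \in xs]xsa orbT.
have [//|Q QQs QP] := QsP (P 0%N) _ xsP; first exact: primeP.
(* If Q = m, the chain starts at m and has length 0. Otherwise y is in P_0 but not in Q, and
   prepending Q lengthens the chain. *)
have [Qm|Qm] := eqVneq Q m.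
  case: n PP primeP => // n PP primeP.
  have [P01 nP10] := PP 0%N isT.
  have [idP1 P11 _] := primeP 1%N isT; case: nP10.
  by rewrite (mmax (P 1%N)) // -?Qm // => a /QP/P01.
have [primeQ xsQ] := Qs_prime _ QQs.
rewrite addnS -addSn; apply: bound; apply: (@consP _ Q P) => //.
split=> // /(_ y) PQ; apply: (yQs Q); first by rewrite mem_filter Qm.
by apply: PQ; apply: xsyP; apply: sub_ideal_gen; rewrite /= mem_rcons mem_head.
Qed.

End Dimension.

(** * Perfections *)

Section QuotIdeal.
Variables (R : comPzRingType) (I : set R) (idI : is_ideal I).

Lemma quot_pi_eq0 x : quot_pi I x = 0 <-> I x.
Proof.
rewrite -(rmorph0 (quot_pi I)) quot_piP subr0.
by split=> [|Ix]; [apply: ideal_gen_sub | apply: sub_ideal_gen].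
Qed.

Lemma quot_pi_onto y : exists x, quot_pi I x = y.
Proof. by exists (generic_quotient.repr y); apply: quot_reprK. Qed.

End QuotIdeal.

(* The perfection of B is the colimit of B -> B -> ... along Frobenius; b in
   the n-th copy of B becomes the sequence with value b^(p^(j-n)) at j >= n. *)
Section Perfection.
Variables (p : nat) (p_prime : prime p) (B : comPzRingType).
Hypothesis p0 : p%:R = 0 :> B.

Definition in_frob_seq (_ : prime p) (_ : p%:R = 0 :> B) (y : nat -> B) : bool :=
  `[< exists N, forall n, (N <= n)%N -> y n.+1 = y n ^+ p >].

Lemma in_frob_seq_closed : subring_closed (in_frob_seq p_prime p0).
Proof.
split=> [|x y|x y]; rewrite !unfold_in.
- by apply/asboolP; exists 0%N => n _; rewrite expr1n.
- move=> /asboolP[N xN] /asboolP[K yK]; apply/asboolP; exists (maxn N K) => n.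
  rewrite geq_max => /andP[Nn Kn]; rewrite -[LHS]/(x n.+1 - y n.+1) xN // yK //.
  by rewrite -(frobN p_prime p0) -(frobD p_prime p0).
- move=> /asboolP[N xN] /asboolP[K yK]; apply/asboolP; exists (maxn N K) => n.
  rewrite geq_max => /andP[Nn Kn]; rewrite -[LHS]/(x n.+1 * y n.+1) xN // yK //.
  by rewrite -exprMn.
Qed.

Record frob_seq := FrobSeq { frob_val :> nat -> B;
                             _ : frob_val \in in_frob_seq p_prime p0 }.
HB.instance Definition _ := [isSub for frob_val].
HB.instance Definition _ := [Choice of frob_seq by <:].
HB.instance Definition _ :=
  GRing.SubChoice_isSubComPzRing.Build (nat -> B) _ frob_seq in_frob_seq_closed.

Definition eventually_zero : set frob_seq :=
  [set y | exists N, forall n, (N <= n)%N -> y n = 0].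

Lemma frob_valX (y : frob_seq) k n : (y ^+ k : frob_seq) n = y n ^+ k.
Proof.
by elim: k => [|k IHk]; rewrite ?expr0 // !exprS -IHk.
Qed.

Lemma eventually_zero_ideal : is_ideal eventually_zero.
Proof.
split=> [|a x y [N xN] [K yK]]; first by exists 0%N.
exists (maxn N K) => n; rewrite geq_max => /andP[Nn Kn].
by rewrite -[LHS]/(a n * x n + y n) xN // yK // mulr0 addr0.
Qed.

Definition perfection := quot_ring eventually_zero.

Lemma perfection_pE (y : frob_seq) k :
  quot_pi eventually_zero y ^+ k = quot_pi eventually_zero (y ^+ k) :> perfection.
Proof. by rewrite rmorphXn. Qed.

Lemma perfection_p : p%:R = 0 :> perfection.
Proof.
rewrite -(rmorph_nat (quot_pi eventually_zero)).
apply/(quot_pi_eq0 eventually_zero_ideal); exists 0%N => n _.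
suff -> k : (k%:R : frob_seq) n = k%:R by [].
by elim: k => // k IHk; rewrite -!natr1 -IHk.
Qed.

Lemma perfection_frob0 (a : perfection) : a ^+ p = 0 -> a = 0.
Proof.
have [y <-] := quot_pi_onto a; rewrite perfection_pE.
move=> /(quot_pi_eq0 eventually_zero_ideal)[N yN].
have /asboolP[K yK] := valP y.
apply/(quot_pi_eq0 eventually_zero_ideal); exists (maxn N K).+1 => -[//|n].
rewrite ltnS geq_max => /andP[Nn Kn]; rewrite yK //.
by rewrite -frob_valX yN.
Qed.

Lemma perfection_frob_onto (a : perfection) : exists b : perfection, b ^+ p = a.
Proof.
have [y <-] := quot_pi_onto a.
have /asboolP[K yK] := valP y.
(* A delay by one place is a p-th root; its value at index 0 is immaterial in the colimit. *)
have zP : (fun n => y n.-1) \in in_frob_seq p_prime p0.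
  by apply/asboolP; exists K.+1 => -[//|n]; apply: yK.
exists (quot_pi eventually_zero (FrobSeq zP)); rewrite perfection_pE.
apply/quot_piP; apply: sub_ideal_gen; exists K.+1 => -[//|n] Kn.
by rewrite -[LHS]/((FrobSeq zP ^+ p) n.+1 - y n.+1) frob_valX yK // subrr.
Qed.

Lemma perfection_perfect : perfect_Fp_algebra p perfection.
Proof.
split; first exact: perfection_p.
pose g (a : perfection) := projT1 (cid (perfection_frob_onto a)).
have gK a : g a ^+ p = a by rewrite /g; case: cid.
exists g => [a|//].
apply/eqP; rewrite -subr_eq0; apply/eqP/perfection_frob0.
by rewrite (frobD p_prime perfection_p) (frobN p_prime perfection_p) gK subrr.
Qed.

Lemma perfection_reduced : reduced perfection.
Proof.
(* Since n <= p^n, also a^(p^n) = 0, and injectivity of Frobenius applies n times. *)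
move=> a n an; have {an} : a ^+ (p ^ n) = 0.
  have /subnK <- : (n <= p ^ n)%N by apply/ltnW/ltn_expl/prime_gt1.
  by rewrite exprD an mulr0.
elim: n => [|n IHn]; first by rewrite expn0 expr1.
by rewrite expnSr exprM => /perfection_frob0.
Qed.

Lemma perfection_neq0 : (1 : B) <> 0 -> (1 : perfection) <> 0.
Proof.
move=> B1; rewrite -(rmorph1 (quot_pi eventually_zero)).
move=> /(quot_pi_eq0 eventually_zero_ideal)[N /(_ N (leqnn N))].
exact: B1.
Qed.

Lemma to_frob_seq_subproof (b : B) :
  (fun n => b ^+ (p ^ n)) \in in_frob_seq p_prime p0.
Proof. by apply/asboolP; exists 0%N => n _; rewrite expnSr exprM. Qed.

Definition to_perfection (b : B) : perfection :=
  quot_pi eventually_zero (FrobSeq (to_frob_seq_subproof b)).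

Lemma to_perfection_zmod : zmod_morphism to_perfection.
Proof.
move=> a b; rewrite /to_perfection -rmorphB; congr (quot_pi _ _).
apply: val_inj; apply/funext => n /=.
rewrite -[RHS]/(a ^+ (p ^ n) - b ^+ (p ^ n)).
elim: n => [|n IHn]; first by rewrite expn0 !expr1.
by rewrite expnSr !exprM IHn (frobD p_prime p0) (frobN p_prime p0).
Qed.

Lemma to_perfection_monoid : monoid_morphism to_perfection.
Proof.
split=> [|a b]; rewrite /to_perfection.
  rewrite -(rmorph1 (quot_pi eventually_zero)); congr (quot_pi _ _).
  by apply: val_inj; apply/funext => n /=; rewrite expr1n.
rewrite -rmorphM; congr (quot_pi _ _).
by apply: val_inj; apply/funext => n /=; rewrite exprMn.
Qed.

HB.instance Definition _ :=
  GRing.isZmodMorphism.Build B perfection to_perfection to_perfection_zmod.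
HB.instance Definition _ :=
  GRing.isMonoidMorphism.Build B perfection to_perfection to_perfection_monoid.

End Perfection.

Section AlgebraOfMorphism.
Variables (R : comNzRingType) (B : comPzRingType) (phi : {rmorphism R -> B}).
Hypothesis B1 : (1 : B) <> 0.

(** A copy of B indexed by [phi] and by 1 <> 0, to which the structure of a nonzero R-algebra is
    attached. *)
Definition rmorph_alg (_ : {rmorphism R -> B}) (_ : (1 : B) <> 0) : Type := B.
Local Notation A := (rmorph_alg phi B1).

HB.instance Definition _ := GRing.ComPzRing.on A.

Lemma rmorph_alg_neq0 : (1 : A) != 0. Proof. exact/eqP. Qed.
HB.instance Definition _ := GRing.PzSemiRing_isNonZero.Build A rmorph_alg_neq0.

Definition rmorph_scale (a : R) (x : A) : A := (phi a : A) * x.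

Lemma rmorph_scaleA a b x : rmorph_scale a (rmorph_scale b x) = rmorph_scale (a * b) x.
Proof. by rewrite /rmorph_scale mulrA (rmorphM phi). Qed.

Lemma rmorph_scale1 : left_id 1 rmorph_scale.
Proof. by move=> x; rewrite /rmorph_scale (rmorph1 phi) mul1r. Qed.

Lemma rmorph_scaleDr : right_distributive rmorph_scale +%R.
Proof. by move=> a x y; rewrite /rmorph_scale mulrDr. Qed.

Lemma rmorph_scaleDl x : {morph rmorph_scale^~ x : a b / a + b}.
Proof. by move=> a b; rewrite /rmorph_scale (rmorphD phi) mulrDl. Qed.

HB.instance Definition _ := GRing.Zmodule_isLmodule.Build R A
  rmorph_scaleA rmorph_scale1 rmorph_scaleDr rmorph_scaleDl.

Lemma rmorph_scaleAl (a : R) (x y : A) : a *: (x * y) = (a *: x) * y.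
Proof. exact: mulrA. Qed.
HB.instance Definition _ := GRing.Lmodule_isLalgebra.Build R A rmorph_scaleAl.
HB.instance Definition _ := GRing.Lalgebra_isComAlgebra.Build R A.

End AlgebraOfMorphism.

(** Take u = 1 and f_0 = p = 0 with all roots 0; the quotient by the zero ideal is A again, and
    Frobenius is inverted through representatives. *)
Lemma perfect_mod_p_roots_perfect (p : nat) (A : comPzRingType) : prime p ->
  reduced A -> perfect_Fp_algebra p A -> perfect_mod_p_roots p A.
Proof.
move=> p_prime redA [p0 [g gK Kg]]; split=> //; exists 1, (fun=> 0).
have expp0 : 0 ^+ p = 0 :> A by rewrite expr0n gtn_eqF ?prime_gt0.
split=> //; [by exists 1; rewrite mulr1 | by rewrite p0 mulr0 |].
set S := range _; pose q : {rmorphism A -> quot_ring S} := quot_pi S.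
have qE x : q (generic_quotient.repr x) = x by apply: quot_reprK.
have q_inj x : q x = 0 -> x = 0.
  rewrite -(rmorph0 q) => /quot_piP; rewrite subr0.
  by apply: (ideal_gen_sub (@submodule_set0 A A^o)) => _ [_ _ <-].
split; first by rewrite -(rmorph_nat q) p0 rmorph0.
exists (fun x => q (g (generic_quotient.repr x))) => x.
  rewrite -[RHS]qE; congr (q _); rewrite -[RHS]gK; congr (g _).
  apply/eqP; rewrite -subr_eq0; apply/eqP/q_inj.
  by rewrite (rmorphB q) (rmorphXn q) /= !qE subrr.
by rewrite -rmorphXn Kg qE.
Qed.

Lemma residue_perfection (p : nat) (R : comNzRingType) (m : set R) :
  prime p -> maximal_ideal m -> m p%:R ->
  exists A : comAlgType R, perfect_mod_p_roots p A /\
    forall a (x : A), m a -> a *: x = 0.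
Proof.
move=> p_prime [idm m1 _] mp.
have p0 : p%:R = 0 :> quot_ring m.
  by rewrite -(rmorph_nat (quot_pi m)); apply/(quot_pi_eq0 idm).
have k1 : (1 : quot_ring m) <> 0.
  by rewrite -(rmorph1 (quot_pi m)) => /(quot_pi_eq0 idm).
pose phi : {rmorphism R -> perfection p_prime p0} :=
  to_perfection p_prime p0 \o quot_pi m.
exists (rmorph_alg phi (perfection_neq0 k1)); split.
  apply: perfect_mod_p_roots_perfect => //; first exact: perfection_reduced.
  exact: perfection_perfect.
move=> a x ma; rewrite -[LHS]/(phi a * x) /phi /=.
have -> : quot_pi m a = 0 by apply/(quot_pi_eq0 idm).
by rewrite rmorph0 mul0r.
Qed.

Theorem corollary3p12 (p : nat) (p_prime : prime p) (R : comNzRingType)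
    (m : set R) (R_noeth : noetherian R) (R_local : local_ring m) (pm : m p%:R)
    (M : lmodType R) (M_neq0 : exists x : M, x <> 0)
    (M_complete : adically_complete m M) :
  balanced_bigCM m M <->
  exists A : comAlgType R,
    [/\ smul m [set: A] <> setT,
        perfectoid p_prime A \/ perfect_mod_p_roots p A
      & forall i : nat, (i < krull_dim R)%N -> Ext_eq0 i A M].
Proof.
have [m_max _] := R_local.
split=> [[_ balM]|[A [mA _ ExtA]]]; last exact: Ext_eq0_balanced ExtA.
have [A [rootsA mA0]] := residue_perfection p_prime m_max pm.
exists A; split; [|by right|].
  (* As m kills A, mA = A would give 1 = 0. *)
  move=> mA; have : smul m [set: A] 1 by rewrite mA.
  move=> /(smul_sub submodule_set0 (fun a x ma _ => mA0 a x ma)) /eqP.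
  by rewrite oner_eq0.
(* Were there no longest chain of primes, the default dimension 0 would leave no degree i to
   treat. *)
move=> i; rewrite /krull_dim; case: xgetP => [d dE [_ dmax]|//].
have [xs sz rad] := sop_exists R_noeth R_local dmax.
rewrite -sz => lti; apply: (Ext_eq0_regular _ _ lti).
  by apply: balM; split; rewrite // sz /krull_dim dE.
move=> y ys x; apply: mA0; rewrite -rad; exists 1%N; rewrite expr1.
exact: sub_ideal_gen.
Qed.
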